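(* Under the linear mixture assumption, run RAVI-UCB for linear mixture MDPs with $\pi_0$ uniform, $V_0=0$ (i.e. $Q_1\equiv0$), $\lambda=1$, $\eta=\sqrt{2\log|\mathcal A|/(H^2T)}$ and $$\beta=H\sqrt{2\Big(\tfrac d2\log\Big[1+\tfrac{TB^2H^2}{d}\Big]+\log T\Big)}+B .$$ Then $$\mathfrak R_T=\widetilde O\Big(\sqrt{\big(d^2H^3+B^2dH+H^4\log|\mathcal A|\big)T}\Big),$$ where $\widetilde O$ hides logarithmic factors in $T,B,d,H$.
   Context: Setting: a discounted MDP with finite state space $\mathcal X$, finite action space $\mathcal A$, known reward $r:\mathcal X\times\mathcal A\to[0,1]$, unknown transition kernel $P$, discount factor $\gamma\in(0,1)$, initial distribution $\nu_0$; $H=1/(1-\gamma)$; $\Pi_Hf(z)=\max(\min(f(z),H),0)$; $\|v\|_Z=\sqrt{v^\top Zv}$. For a stationary policy $\pi$, $\nu^\pi(x)=(1-\gamma)\sum_{t\ge0}\gamma^t\mathbb P_\pi[X_t=x]$ with $X_0\sim\nu_0$, $\mu^\pi(x,a)=\nu^\pi(x)\pi(a|x)$, $\langle\mu,f\rangle=\sum_{x,a}\mu(x,a)f(x,a)$; $\mu^*$ is the occupancy measure of an optimal policy. Linear mixture assumption: there is a known $\psi:\mathcal X\times\mathcal A\times\mathcal X\to\mathbb R^d$ and unknown $\theta\in\mathbb R^d$ with $\|\theta\|_2\le B$ such that $P(x'|x,a)=\sum_{i=1}^d\theta_i\psi_i(x,a,x')$, and for all $(x,a)$ and all $V\in[0,H]^{\mathcal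 X}$, $\|\sum_{x'}\psi(x,a,x')V(x')\|_2\le BH$. RAVI-UCB for linear mixture MDPs (parameters $T$, $\eta>0$, $\beta>0$, $\lambda>0$, initial policy $\pi_0$; $Q_1\equiv0$, $\Lambda_1=\lambda I$, $b_1=0$, $t=1$, $x_1\sim\nu_0$). For epochs $k=1,2,\dots$: $T_k=t$; $\widehat\theta_k=\Lambda_{T_k}^{-1}b_{T_k}$, $\widehat P_k=\sum_i\widehat\theta_{k,i}\psi_i$; $V_k(x)=\frac1\eta\log\sum_a\pi_{k-1}(a|x)e^{\eta Q_k(x,a)}$; $\pi_k(a|x)=\pi_{k-1}(a|x)e^{\eta(Q_k(x,a)-V_k(x))}$; $\phi_k(x,a)=\sum_{x'}\psi(x,a,x')V_k(x')$; $\mathrm{CB}_k(x,a)=\beta\|\phi_k(x,a)\|_{\Lambda_{T_k}^{-1}}$; $Q_{k+1}=\Pi_H[r+\mathrm{CB}_k+\gamma\widehat P_kV_k]$ where $(\widehat P_kf)(x,a)=\sum_{x'}\widehat P_k(x'|x,a)f(x')$. Then repeat: play $a_t\sim\pi_k(\cdot|x_t)$, observe $x_{t+1}\sim P(\cdot|x_t,a_t)$, update $\Lambda_{t+1}=\Lambda_t+\phi_k(x_t,a_t)\phi_k(x_t,a_t)^\top$, $b_{t+1}=b_t+\phi_k(x_t,a_t)V_k(x_{t+1})$, set $t\leftarrow t+1$; with probability $1-\gamma$ reset (redraw current state from $\nu_0$) and end the epoch; stop when $t=T$. For $t$ in epoch $k$ write $\pi_t=\pi_k$. Expected regret: $\mathfrak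 R_T=\mathbb E\big[\sum_{t=1}^T(\langle\mu^*,r\rangle-\langle\mu^{\pi_t},r\rangle)\big]$. *)

(* Defs.v *)
From HB Require Import structures.
From mathcomp Require Import all_boot all_order all_algebra.
From mathcomp Require Import all_classical all_reals all_analysis.
Set Implicit Arguments. Unset Strict Implicit. Unset Printing Implicit Defensive.
Import Order.TTheory GRing.Theory Num.Theory.
Local Open Scope ring_scope.

Section MDP.
Variables (R : realType) (X A : finType) (d : nat).

Definition norm2 (v : 'cV[R]_d) : R := Num.sqrt (\sum_i v i ord0 ^+ 2).
Definition wnorm (Z : 'M[R]_d) (v : 'cV[R]_d) : R := Num.sqrt ((v^T *m Z *m v) ord0 ord0).

Definition clipH (H y : R) : R := Num.max (Num.min y H) 0.

Definition is_distr (nu : X -> R) := (forall x, 0 <= nu x) /\ \sum_x nu x = 1.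
Definition is_policy (pi : X -> A -> R) :=
  forall x, (forall a, 0 <= pi x a) /\ \sum_a pi x a = 1.
Definition is_kernel (P : X -> A -> X -> R) :=
  forall x a, (forall y, 0 <= P x a y) /\ \sum_y P x a y = 1.

Variables (P : X -> A -> X -> R) (gamma : R).

Fixpoint state_law (nu : X -> R) (pi : X -> A -> R) (t : nat) : X -> R :=
  match t with
  | 0 => nu
  | t'.+1 => fun y => \sum_x state_law nu pi t' x * \sum_a pi x a * P x a y
  end.

Definition state_occ (nu : X -> R) (pi : X -> A -> R) (x : X) : R :=
  (1 - gamma) * limn (fun n => \sum_(t < n) gamma ^+ t * state_law nu pi t x).

Definition occ_dot (nu : X -> R) (pi : X -> A -> R) (f : X -> A -> R) : R :=
  \sum_x \sum_a state_occ nu pi x * pi x a * f x a.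

Definition dirac (x0 : X) : X -> R := fun x => (x == x0)%:R.

Definition optimal_policy (r : X -> A -> R) (pis : X -> A -> R) :=
  is_policy pis /\
  forall pi, is_policy pi -> forall x, occ_dot (dirac x) pi r <= occ_dot (dirac x) pis r.

Variables (psi : X -> A -> X -> 'cV[R]_d) (r : X -> A -> R) (nu0 : X -> R).
Variables (eta beta H : R).

Definition softV (piprev Q : X -> A -> R) (x : X) : R :=
  eta^-1 * ln (\sum_a piprev x a * expR (eta * Q x a)).

Definition newpi (piprev Q : X -> A -> R) : X -> A -> R :=
  fun x a => piprev x a * expR (eta * (Q x a - softV piprev Q x)).

Definition feat (V : X -> R) (x : X) (a : A) : 'cV[R]_d :=
  \sum_y V y *: psi x a y.

Definition newQ (L : 'M[R]_d) (b : 'cV[R]_d) (V : X -> R) : X -> A -> R :=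
  let th := invmx L *m b in
  fun x a => clipH H (r x a + beta * wnorm (invmx L) (feat V x a)
                      + gamma * \sum_y (\sum_i th i ord0 * psi x a y i ord0) * V y).

Definition gap (pis pi : X -> A -> R) : R :=
  occ_dot nu0 pis r - occ_dot nu0 pi r.

(* Expected sum of gaps over the next n rounds, for an algorithm state at the
   beginning of a round: current state x, statistics L (=Lambda_t), b (=b_t),
   current epoch policy pi (=pi_k), its V (=V_k), and Qn (=Q_{k+1}).
   One round: a ~ pi(.|x), x' ~ P(.|x,a), update L, b; with prob. gamma the epoch
   continues from x'; with prob. 1-gamma the state is redrawn from nu0 and a new
   epoch starts (theta_hat, V, pi, Q recomputed from the current L, b). *)
Fixpoint exp_regret (pis : X -> A -> R) (n : nat) (x : X) (L : 'M[R]_d)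
    (b : 'cV[R]_d) (pi : X -> A -> R) (V : X -> R) (Qn : X -> A -> R) : R :=
  match n with
  | 0 => 0
  | n'.+1 =>
    gap pis pi +
    \sum_a pi x a * \sum_y P x a y *
      (let ph := feat V x a in
       let L' := L + ph *m ph^T in
       let b' := b + V y *: ph in
       gamma * exp_regret pis n' y L' b' pi V Qn +
       (1 - gamma) * \sum_z nu0 z *
          (let V2 := softV pi Qn in
           let pi2 := newpi pi Qn in
           exp_regret pis n' z L' b' pi2 V2 (newQ L' b' V2)))
  end.

Definition ravi_ucb_regret (pis : X -> A -> R) (T : nat) (lambda : R)
    (pi0 Q1 : X -> A -> R) : R :=
  let L1 := lambda%:M : 'M[R]_d in
  let b1 := 0 : 'cV[R]_d in
  let V1 := softV pi0 Q1 in
  \sum_z nu0 z * exp_regret pis T z L1 b1 (newpi pi0 Q1) V1 (newQ L1 b1 V1).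

End MDP.

(* Main.v *)
(** Write Z for the self-normalized process exp(|S|^2 / (2 H^2)) / sqrt(det Lambda),
    with S the accumulated noise and |.| the norm of Lambda^-1.  It is a
    supermartingale, so the event Z > T costs at most E[Z] rounds in expectation;
    as long as Z <= T, the estimate Q_(k+1) lies between r + gamma P V_k and the
    same quantity plus twice the bonus.

    In that case the gap of pi_k telescopes, up to a small drift and the expected
    bonus, along the potential
      <nu^pi, V> - <nu*, V> - (1/eta) <mu*, ln pi>,
    because the softmax update moves policies, hence occupancy measures, slowly.

    The last state-action pair of an epoch is distributed according to the
    occupancy measure of the policy of that epoch, and its rank-one update alone
    raises ln det Lambda by at least half of min(1, |phi|^2).  Hence the expected
    bonus is paid for by the growth of the log-determinant, even though the
    bonus uses the matrix frozen at the beginning of the epoch.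

    All three quantities are carried along in one bound on the expected regret
    of the remaining n rounds, proved by induction on n. *)
Require Import Defs.
From HB Require Import structures.
From mathcomp Require Import all_boot all_order all_algebra.
From mathcomp Require Import all_classical all_reals all_analysis.
From mathcomp Require Import ring lra.
Set Implicit Arguments. Unset Strict Implicit. Unset Printing Implicit Defensive.
Import Order.TTheory GRing.Theory Num.Theory.
Import numFieldNormedType.Exports.
Local Open Scope ring_scope.

(** * Elementary inequalities for the exponential and the square root *)

Section Scalar.
Variable R : realType.
Implicit Types x a g u e : R.

Lemma expR_convex a x (y : R) : 0 <= a <= 1 ->
  expR (a * x + (1 - a) * y) <= a * expR x + (1 - a) * expR y.
Proof.
move=> /andP[a0 a1].
(* Tangent line of exp at [m]. Taken at the barycenter of [x] and [y], the linear terms cancel in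
   the weighted sum. *)
have E (m z : R) : expR m * (1 + (z - m)) <= expR z.
  rewrite -[X in _ <= expR X](subrK m z) expRD [leRHS]mulrC.
  by apply: ler_wpM2l; [exact: expR_ge0 | exact: expR_ge1Dx].
set m := a * x + (1 - a) * y.
have hx := ler_wpM2l a0 (E m x).
have a2 : 0 <= 1 - a by lra.
have hy := ler_wpM2l a2 (E m y).
apply: le_trans (lerD hx hy).
rewrite le_eqVlt; apply/orP; left; apply/eqP.
by rewrite /m; ring.
Qed.

Lemma expR_le_inv x : x < 1 -> expR x <= (1 - x)^-1.
Proof.
move=> x1; have := expR_ge1Dx (- x); rewrite expRN => h.
have p : 0 < 1 - x by lra.
by rewrite -[expR x]invrK lef_pV2 ?posrE ?invr_gt0 ?expR_gt0//; lra.
Qed.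

Lemma expR_half_le x : 0 <= x <= 1 -> expR (x / 2) <= 1 + x.
Proof.
move=> /andP[x0 x1]; apply: le_trans (expR_le_inv _) _; first lra.
have p : 0 < 1 - x / 2 by lra.
rewrite -[_^-1]mul1r ler_pdivrMr//; nra.
Qed.

Lemma expR_quad_le x : `|x| <= 2^-1 -> expR x <= 1 + x + 2 * x ^+ 2.
Proof.
rewrite ler_norml => /andP[x0 x1]; apply: le_trans (expR_le_inv _) _; first lra.
have p : 0 < 1 - x by lra.
rewrite -[_^-1]mul1r ler_pdivrMr//; nra.
Qed.

Lemma expR_sub1_le x (y : R) : `|x| <= y -> y <= 2^-1 -> `|expR x - 1| <= 2 * y.
Proof.
rewrite ler_norml => /andP[x0 x1] y1.
have h1 := expR_ge1Dx x.
have p : 0 < 1 - x by lra.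
have h2 : expR x <= 1 + 2 * y.
  apply: le_trans (expR_le_inv _) _; first lra.
  rewrite -[_^-1]mul1r ler_pdivrMr//; nra.
by rewrite ler_norml; apply/andP; split; lra.
Qed.

Lemma nonincreasing_is_derive (f df : R -> R) :
  (forall x, is_derive x 1 f (df x)) -> (forall x, 0 < x -> df x <= 0) ->
  forall x, 0 <= x -> f x <= f 0.
Proof.
move=> fd df0 x x0; apply: (@ler0_derive1_nincry R f 0) => //.
- by move=> y; rewrite in_itv/= andbT => y0; rewrite derive1E (@derive_val _ _ _ _ _ _ _ (fd y)); exact: df0.
- by apply: derivable_within_continuous.
Qed.

(** The left side divided by [expR (x ^+ 2 / 2)] is [K]. Its derivative is
    [expR (- (x ^+ 2 / 2)) * N x], and [N] vanishes at 0 and decreases on the positive half-line. *)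
Lemma coshR_le x : expR x + expR (- x) <= 2 * expR (x ^+ 2 / 2).
Proof.
wlog x0 : x / 0 <= x.
  move=> h; case: (leP 0 x) => [/h//|x0].
  by have := h (- x); rewrite opprK sqrrN addrC; apply; lra.
pose N x := (1 - x) * expR x - (1 + x) * expR (- x) : R.
have N0 y : 0 <= y -> N y <= 0.
  move=> y0.
  have -> : 0 = N 0 by rewrite /N oppr0 expR0; ring.
  apply: (@nonincreasing_is_derive N (fun x => - x * (expR x - expR (- x)))) => //.
    move=> z; apply: is_derive_eq.
    by rewrite /GRing.scale/=; ring.
  move=> z z0.
  have : expR (- z) <= expR z by rewrite ler_expR; lra.
  nra.
pose K x := expR (x - x ^+ 2 / 2) + expR (- x - x ^+ 2 / 2) : R.
have K2 : K x <= 2.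
  have -> : 2 = K 0 by rewrite /K oppr0 expr0n/= mul0r subr0 expR0; ring.
  apply: (@nonincreasing_is_derive K (fun x => expR (- (x ^+ 2 / 2)) * N x)) => //.
    move=> z; apply: is_derive_eq.
    by rewrite /N /GRing.scale/= !expRD; field.
  move=> z z0; rewrite pmulr_rle0 ?expR_gt0//; apply: N0; lra.
move: K2; rewrite /K !expRD -mulrDl [expR (- (_ / _))]expRN.
by rewrite ler_pdivrMr ?expR_gt0.
Qed.

(** Squaring works because u/(1+u) is at most both 1 and u. The quarter matches the variance bound
    used in [self_normalized_step]. *)
Lemma one_plus_frac_le_sqrt u : 0 <= u -> 1 + u / (1 + u) / 4 <= Num.sqrt (1 + u).
Proof.
move=> u0; have p : 0 < 1 + u by lra.
set q := u / (1 + u).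
have q0 : 0 <= q by rewrite divr_ge0// ltW.
have q1 : q <= u by rewrite ler_pdivrMr//; nra.
have q2 : q <= 1 by rewrite ler_pdivrMr//; lra.
have -> : 1 + q / 4 = Num.sqrt ((1 + q / 4) ^+ 2).
  by rewrite sqrtr_sqr ger0_norm//; lra.
by rewrite ler_sqrt; nra.
Qed.

(** * Exponential moments of a centered bounded variable *)

Section Hoeffding.
Variables (X : finType) (p v : X -> R).
Hypotheses (pd : is_distr p) (v01 : forall y, 0 <= v y <= 1).
Let m := \sum_y p y * v y.

Lemma distr_mean_const (c : R) : \sum_y p y * c = c.
Proof. by rewrite -mulr_suml pd.2 mul1r. Qed.

Lemma distr_mean_le (f1 f2 : X -> R) :
  (forall y, f1 y <= f2 y) -> \sum_y p y * f1 y <= \sum_y p y * f2 y.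
Proof. by move=> h; apply: ler_sum => y _; rewrite ler_wpM2l// pd.1. Qed.

Lemma mean01 : 0 <= m <= 1.
Proof.
apply/andP; split.
  rewrite -[leLHS](distr_mean_const 0); apply: distr_mean_le => y.
  by case/andP: (v01 y).
rewrite -[leRHS](distr_mean_const 1); apply: distr_mean_le => y.
by case/andP: (v01 y).
Qed.

Lemma centered_mean0 : \sum_y p y * (v y - m) = 0.
Proof.
under eq_bigr do rewrite mulrBr.
by rewrite sumrB distr_mean_const subrr.
Qed.

Lemma centered_bound y : `|v y - m| <= 1.
Proof.
case/andP: mean01 => m0 m1; case/andP: (v01 y) => v0 v1.
by rewrite ler_norml; apply/andP; split; lra.
Qed.

Lemma variance_le : \sum_y p y * (v y - m) ^+ 2 <= 4^-1.
Proof.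
(* The difference of the two sides is [v y * (1 - v y)]. The linear term has mean zero, and m(1-m)
   is at most 1/4. *)
have h y : (v y - m) ^+ 2 <= (1 - 2 * m) * (v y - m) + m * (1 - m).
  by case/andP: (v01 y) => v0 v1; nra.
apply: le_trans (distr_mean_le h) _.
under eq_bigr do rewrite mulrDr mulrCA.
rewrite big_split/= -mulr_sumr centered_mean0 mulr0 add0r distr_mean_const.
have := sqr_ge0 (m - 2^-1); lra.
Qed.

Lemma expR_chord e g : `|e| <= 1 ->
  expR (e * g) <= (expR g + expR (- g)) / 2 + e * ((expR g - expR (- g)) / 2).
Proof.
rewrite ler_norml => /andP[e0 e1].
have h : 0 <= (1 + e) / 2 <= 1 by apply/andP; split; lra.
have := expR_convex g (- g) h.
have -> : (1 + e) / 2 * g + (1 - (1 + e) / 2) * - g = e * g by field.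
lra.
Qed.

(** The linear part of the chord averages to zero, which leaves cosh g. The deviations are merely
    placed in [-1, 1], hence g^2/2 rather than the sharp g^2/8. *)
Lemma hoeffding_mgf g : \sum_y p y * expR ((v y - m) * g) <= expR (g ^+ 2 / 2).
Proof.
apply: le_trans (distr_mean_le (fun y => expR_chord g (centered_bound y))) _.
under eq_bigr do rewrite mulrDr.
rewrite big_split/= distr_mean_const.
under eq_bigr do rewrite mulrA.
rewrite -mulr_suml centered_mean0 mul0r addr0.
have := coshR_le g; lra.
Qed.

(* The convex split of the exponent with weights 1/(1+u) and u/(1+u) replaces
   the Gaussian mixture of the usual self-normalized bound. *)
Lemma self_normalized_step g u : 0 <= u ->
  \sum_y p y * expR ((2 * (v y - m) * g - g ^+ 2 + (v y - m) ^+ 2 * u) / (2 * (1 + u)))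
    <= Num.sqrt (1 + u).
Proof.
move=> u0; apply: le_trans _ (one_plus_frac_le_sqrt u0).
have pu : 0 < 1 + u by lra.
set a := (1 + u)^-1.
have a0 : 0 <= a by rewrite invr_ge0 ltW.
have a1 : a <= 1 by rewrite invf_le1//; lra.
have ua : u / (1 + u) = 1 - a by rewrite /a; field; lra.
rewrite ua.
have h y : expR ((2 * (v y - m) * g - g ^+ 2 + (v y - m) ^+ 2 * u) / (2 * (1 + u)))
    <= a * (expR ((v y - m) * g) / expR (g ^+ 2 / 2)) +
       (1 - a) * (1 + (v y - m) ^+ 2).
  have -> : (2 * (v y - m) * g - g ^+ 2 + (v y - m) ^+ 2 * u) / (2 * (1 + u)) =
     a * ((v y - m) * g - g ^+ 2 / 2) + (1 - a) * ((v y - m) ^+ 2 / 2).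
    by rewrite -ua /a; field; lra.
  have a01 : 0 <= a <= 1 by rewrite a0.
  apply: le_trans (expR_convex _ _ a01) _; rewrite expRB lerD2l.
  apply: ler_wpM2l; first lra.
  apply: expR_half_le; rewrite sqr_ge0/=.
  by have := centered_bound y; rewrite ler_norml => /andP[]; nra.
apply: le_trans (distr_mean_le h) _.
have -> : \sum_y p y * (a * (expR ((v y - m) * g) / expR (g ^+ 2 / 2)) +
       (1 - a) * (1 + (v y - m) ^+ 2)) =
    a * ((\sum_y p y * expR ((v y - m) * g)) / expR (g ^+ 2 / 2)) +
    (1 - a) * (\sum_y p y * 1 + \sum_y p y * (v y - m) ^+ 2).
  rewrite mulr_suml -big_split/= !mulr_sumr -big_split/=.
  by apply: eq_bigr => y _; ring.
rewrite distr_mean_const.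
have h1 : (\sum_y p y * expR ((v y - m) * g)) / expR (g ^+ 2 / 2) <= 1.
  by rewrite ler_pdivrMr ?expR_gt0// mul1r hoeffding_mgf.
have h2 := variance_le.
nra.
Qed.

End Hoeffding.
End Scalar.

(** * Positive definite matrices: determinants, inverses and rank-one updates *)

Section PosDef.
Variable R : realType.

Definition bform n (M : 'M[R]_n) (x y : 'cV[R]_n) : R := (x^T *m M *m y) ord0 ord0.

Definition posdef n (M : 'M[R]_n) :=
  M^T = M /\ forall v : 'cV[R]_n, v != 0 -> 0 < bform M v v.

Section Bform.
Variable n : nat.
Implicit Types (M N : 'M[R]_n) (x y z u v : 'cV[R]_n).

Lemma bformDl M x y z : bform M (x + y) z = bform M x z + bform M y z.
Proof. by rewrite /bform linearD/= !mulmxDl mxE. Qed.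

Lemma bformDr M x y z : bform M x (y + z) = bform M x y + bform M x z.
Proof. by rewrite /bform mulmxDr mxE. Qed.

Lemma bformZl M c x y : bform M (c *: x) y = c * bform M x y.
Proof. by rewrite /bform linearZ/= -!scalemxAl mxE. Qed.

Lemma bformZr M c x y : bform M x (c *: y) = c * bform M x y.
Proof. by rewrite /bform -scalemxAr mxE. Qed.

Lemma bform0 M x : bform M x 0 = 0.
Proof. by rewrite /bform mulmx0 mxE. Qed.

Lemma bformMD M N x y : bform (M + N) x y = bform M x y + bform N x y.
Proof. by rewrite /bform mulmxDr mulmxDl mxE. Qed.

Lemma bformMB M N x y : bform (M - N) x y = bform M x y - bform N x y.
Proof. by rewrite /bform mulmxBr mulmxBl !mxE. Qed.

Lemma bformMZ M c x y : bform (c *: M) x y = c * bform M x y.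
Proof. by rewrite /bform -scalemxAr -scalemxAl mxE. Qed.

Lemma bform_sym M x y : M^T = M -> bform M x y = bform M y x.
Proof.
move=> sM; rewrite /bform.
have -> : y^T *m M *m x = (x^T *m M *m y)^T by rewrite !trmx_mul trmxK sM mulmxA.
by rewrite [RHS]mxE.
Qed.

Lemma bform_shift M N x y : bform (M *m N) x y = bform M x (N *m y).
Proof. by rewrite /bform !mulmxA. Qed.

Lemma bform1E x y : bform 1%:M x y = \sum_i x i ord0 * y i ord0.
Proof. by rewrite /bform mulmx1 mxE; apply: eq_bigr => i _; rewrite mxE. Qed.

Lemma bform_rank1 u x y :
  bform (u *m u^T) x y = bform 1%:M u x * bform 1%:M u y.
Proof.
rewrite (@bform_sym 1%:M u x) ?trmx1// /bform !mulmx1.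
by rewrite mulmxA -mulmxA [LHS]mxE big_ord1.
Qed.

Lemma bform1_ge0 x : 0 <= bform 1%:M x x.
Proof. by rewrite bform1E; apply: sumr_ge0 => i _; rewrite -expr2 sqr_ge0. Qed.

Lemma posdef1 : posdef (1%:M : 'M[R]_n).
Proof.
split; first exact: trmx1.
move=> v v0; rewrite lt_neqAle bform1_ge0 andbT eq_sym bform1E.
rewrite psumr_eq0; last by move=> i _; rewrite -expr2 sqr_ge0.
apply: contra v0 => /allP h; apply/eqP/colP => i; rewrite mxE.
by have := h i (mem_index_enum i); rewrite -expr2 sqrf_eq0 => /eqP.
Qed.

Lemma posdef_ge0 M v : posdef M -> 0 <= bform M v v.
Proof.
move=> [_ h]; case: (eqVneq v 0) => [->|/h/ltW//].
by rewrite bform0.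
Qed.

Lemma posdefD_rank1 M u : posdef M -> posdef (M + u *m u^T).
Proof.
move=> [sM h]; split; first by rewrite linearD/= trmx_mul trmxK sM.
by move=> v /h hv; rewrite bformMD bform_rank1 -expr2 ltr_wpDr// sqr_ge0.
Qed.

Lemma posdefZ c M : 0 < c -> posdef M -> posdef (c *: M).
Proof.
move=> c0 [sM h]; split; first by rewrite linearZ/= sM.
by move=> v /h hv; rewrite bformMZ mulr_gt0.
Qed.

Lemma tr_rank1 u : \tr (u *m u^T) = bform 1%:M u u.
Proof. by rewrite mxtrace_mulC trace_mx11 /bform mulmx1. Qed.

End Bform.

(** The form is evaluated at vectors (s, v). The vector (1, 0) gives [a], and the minimizing s =
    -(w.v)/a leaves exactly the Schur complement. *)
Lemma posdef_schur n (a : R) (w : 'cV[R]_n) (N : 'M[R]_n) :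
  posdef (block_mx a%:M w^T w N : 'M[R]_(1 + n)) ->
  0 < a /\ posdef (N - a^-1 *: (w *m w^T)).
Proof.
move=> [sM h].
have E (s : R) (v : 'cV[R]_n) :
    bform (block_mx a%:M w^T w N : 'M[R]_(1 + n)) (col_mx s%:M v) (col_mx s%:M v) =
    a * s ^+ 2 + 2 * s * bform 1%:M w v + bform N v v.
  rewrite /bform mulmx1; set A := w^T *m v; set B := v^T *m N *m v.
  have -> : (col_mx s%:M v)^T *m block_mx a%:M w^T w N *m col_mx s%:M v =
      (s * a * s)%:M + s *: A^T + (s *: A + B).
    rewrite tr_col_mx mul_row_block mul_row_col tr_scalar_mx !mulmxDl.
    rewrite /A trmx_mul trmxK mul_mx_scalar !mul_scalar_mx -!scalemxAl.
    by rewrite mul_mx_scalar !scale_scalar_mx mulrAC mulrA.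
  by rewrite !mxE eqxx mulr1n; ring.
have a0 : 0 < a.
  have nz : col_mx (1%:M : 'cV[R]_1) (0 : 'cV[R]_n) != 0.
    apply/eqP => /(congr1 (fun M : 'cV[R]_(1 + n) => usubmx M ord0 ord0)).
    by rewrite col_mxKu linear0 !mxE => /eqP; rewrite oner_eq0.
  have := h _ nz; rewrite E !bform0; lra.
split=> //; split.
  move: sM; rewrite tr_block_mx => /eq_block_mx[_ _ _ sN].
  by rewrite linearB/= linearZ/= trmx_mul trmxK sN.
move=> v v0; pose s := - (a^-1 * bform 1%:M w v).
have nz : col_mx (s%:M : 'cV[R]_1) v != 0.
  apply: contra v0 => /eqP /(congr1 (fun M : 'cV[R]_(1 + n) => dsubmx M)).
  by rewrite col_mxKd linear0 => ->.
have := h _ nz; rewrite E bformMB bformMZ bform_rank1 /s.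
suff -> : a * (- (a^-1 * bform 1%:M w v)) ^+ 2 +
  2 * - (a^-1 * bform 1%:M w v) * bform 1%:M w v + bform N v v =
  bform N v v - a^-1 * (bform 1%:M w v * bform 1%:M w v) by [].
by field; rewrite gt_eqF.
Qed.

(** Induction on the dimension through Schur complements: the determinant factors as [a * \det N'],
    the trace can only drop, and [a <= expR (a - 1)]. This plays the role of AM-GM on the
    eigenvalues. *)
Lemma posdef_det n (M : 'M[R]_n) : posdef M ->
  0 < \det M <= expR (\tr M - n%:R).
Proof.
elim: n M => [|n IH] M pM.
  by rewrite det_mx00 /mxtrace big_ord0 subr0 expR0 lexx ltr01.
have [a [w [N EM]]] : exists (a : R) (w : 'cV[R]_n) (N : 'M[R]_n),
    M = block_mx a%:M w^T w N :> 'M[R]_(1 + n).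
  exists (@ulsubmx _ 1 n 1 n M ord0 ord0), (@dlsubmx _ 1 n 1 n M), (@drsubmx _ 1 n 1 n M).
  rewrite -[LHS](@submxK _ 1 n 1 n) -mx11_scalar; congr block_mx.
  by rewrite trmx_dlsub pM.1.
move: pM; rewrite EM => /posdef_schur[a0 /IH /andP[d0 d1]].
set N' := N - _ in d0 d1.
have ED : \det (block_mx a%:M w^T w N : 'M[R]_(1 + n)) = a * \det N'.
  have -> : block_mx a%:M w^T w N =
    block_mx 1%:M 0 (a^-1 *: w) 1%:M *m block_mx a%:M w^T 0 N'.
    rewrite mulmx_block !mul1mx !mul0mx !addr0.
    congr block_mx; last by rewrite /N' -scalemxAl addrC subrK.
    by rewrite mul_mx_scalar scalerA mulfV ?scale1r// gt_eqF.
  by rewrite det_mulmx det_lblock det_ublock !det1 !mul1r det_scalar expr1.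
have ET : \tr (block_mx a%:M w^T w N : 'M[R]_(1 + n)) = a + \tr N.
  by rewrite mxtrace_block mxtrace_scalar.
rewrite ED ET mulr_gt0//=.
have h1 : a <= expR (a - 1).
  by apply: le_trans _ (expR_ge1Dx _); lra.
have h2 : \tr N' <= \tr N.
  rewrite linearB/= linearZ/= tr_rank1 gerBl.
  by rewrite mulr_ge0 ?bform1_ge0 ?invr_ge0 ?(ltW a0).
apply: le_trans (ler_pM (ltW a0) (ltW d0) h1 d1) _.
rewrite -expRD ler_expR -natr1; lra.
Qed.

Section Inverse.
Variable n : nat.
Implicit Types (M : 'M[R]_n) (x y z u v : 'cV[R]_n).

Lemma posdef_unit M : posdef M -> M \in unitmx.
Proof. by move=> /posdef_det/andP[d0 _]; rewrite unitmxE unitfE gt_eqF. Qed.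

Lemma posdef_inv M : posdef M -> posdef (invmx M).
Proof.
move=> pM; have uM := posdef_unit pM.
split; first by rewrite trmx_inv pM.1.
move=> v v0; have -> : bform (invmx M) v v = bform M (invmx M *m v) (invmx M *m v).
  by rewrite /bform trmx_mul trmx_inv pM.1 -!mulmxA mulKVmx.
apply: pM.2; apply: contra v0 => /eqP h.
by rewrite -[v](mulKVmx uM) h mulmx0.
Qed.

Lemma det_rank1_update M u : posdef M ->
  \det (M + u *m u^T) = \det M * (1 + bform (invmx M) u u).
Proof.
move=> pM; have uM := posdef_unit pM.
(* The bordered matrix [W] is factored twice, eliminating with the corner 1 or with the block [M];
   the two determinants agree. *)
pose W := block_mx 1%:M (- u^T) u M : 'M[R]_(1 + n).
have E1 : \det W = \det (M + u *m u^T).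
  have -> : W = block_mx 1%:M 0 u 1%:M *m block_mx 1%:M (- u^T) 0 (M + u *m u^T).
    rewrite /W mulmx_block !mul1mx !mul0mx ?mulmx0 !mulmx1 !addr0.
    by rewrite mulmxN addrC addrK.
  by rewrite det_mulmx det_lblock det_ublock !det1 !mul1r.
have E2 : \det W = \det M * (1 + bform (invmx M) u u).
  have -> : W = block_mx (1%:M + u^T *m invmx M *m u) (- (u^T *m invmx M)) 0 1%:M *m
                block_mx 1%:M 0 u M.
    rewrite /W mulmx_block !mul1mx !mul0mx ?mulmx0 ?mulmx1 ?add0r.
    by rewrite !mulNmx -!mulmxA mulVmx// mulmx1 addrK.
  rewrite det_mulmx det_lblock det_ublock !det1 mulr1 mul1r mulrC.
  by congr (_ * _); rewrite det_mx11 mxE [X in X + _]mxE eqxx.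
by rewrite -E1 E2.
Qed.

Lemma sherman_morrison M u x y : posdef M ->
  bform (invmx (M + u *m u^T)) x y = bform (invmx M) x y -
    bform (invmx M) u x * bform (invmx M) u y / (1 + bform (invmx M) u u).
Proof.
move=> pM; have uM := posdef_unit pM.
have uM' := posdef_unit (posdefD_rank1 u pM).
have [sI _] := posdef_inv pM.
have k0 := posdef_ge0 u (posdef_inv pM).
set k := bform _ u u in k0 *.
have -> : invmx (M + u *m u^T) =
    invmx M - (1 + k)^-1 *: (invmx M *m u *m (u^T *m invmx M)).
  set N := RHS.
  suff h : (M + u *m u^T) *m N = 1%:M.
    by rewrite -[RHS](mulKmx uM') h mulmx1.
  have kE : u^T *m invmx M *m u = k%:M by rewrite [LHS]mx11_scalar.
  rewrite /N mulmxBr !mulmxDl mulmxV// -!scalemxAr.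
  rewrite !mulmxA mulmxV// mul1mx.
  have -> : u *m u^T *m invmx M *m u *m u^T *m invmx M = k *: (u *m u^T *m invmx M).
    by rewrite -(mulmxA u u^T) -(mulmxA u _ u) kE mul_mx_scalar -!scalemxAl mulmxA.
  rewrite -addrA -[RHS]addr0; congr (_ + _).
  rewrite -scalerDr -[X in _ *: (X + _)]scale1r -scalerDl scalerA mulVf ?scale1r ?subrr//.
  by rewrite gt_eqF//; lra.
rewrite bformMB bformMZ; congr (_ - _).
rewrite mulrC; congr (_ / _).
rewrite (bform_sym u x sI) /bform.
have -> : x^T *m (invmx M *m u *m (u^T *m invmx M)) *m y =
  x^T *m invmx M *m u *m (u^T *m invmx M *m y) by rewrite !mulmxA.
by rewrite [LHS]mxE big_ord1.
Qed.

Lemma bform_CS M x y : posdef M ->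
  `|bform M x y| <= Num.sqrt (bform M x x) * Num.sqrt (bform M y y).
Proof.
move=> pM.
rewrite -sqrtrM ?posdef_ge0// -sqrtr_sqr ler_wsqrtr//.
case: (eqVneq y 0) => [->|y0]; first by rewrite !bform0 expr0n mulr0.
have yy := pM.2 _ y0.
(* This vector is a multiple of the part of [x] orthogonal to [y]; the form there equals
   [c * (a * c - b ^+ 2)]. *)
have := posdef_ge0 (bform M y y *: x - bform M x y *: y) pM.
rewrite -scaleNr !(bformDl, bformDr, bformZl, bformZr) (bform_sym y x pM.1).
set a := bform M x x; set b := bform M x y; set c := bform M y y in yy *.
move=> h; have {h} : 0 <= c * (a * c - b ^+ 2) by lra.
by rewrite pmulr_rge0// subr_ge0.
Qed.

(** With w = M^-1 x, the hypothesis at w reads |w|^2 <= x.w, and |x - w|^2 >= 0 then gives x.w <=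
    |x|^2. *)
Lemma posdef_inv_le1 M x : posdef M -> (forall v, bform 1%:M v v <= bform M v v) ->
  bform (invmx M) x x <= bform 1%:M x x.
Proof.
move=> pM h; have uM := posdef_unit pM; have [sI _] := posdef_inv pM.
set w := invmx M *m x.
have E1 : bform (invmx M) x x = bform 1%:M x w by rewrite -bform_shift mul1mx.
have E2 : bform M w w = bform (invmx M) x x.
  by rewrite /bform /w trmx_mul sI -!mulmxA mulKVmx.
have := bform1_ge0 (x - w); have := h w.
rewrite E2 -scaleN1r !(bformDl, bformDr, bformZl, bformZr) E1.
rewrite (@bform_sym _ 1%:M w x) ?trmx1//; lra.
Qed.

End Inverse.
End PosDef.

(** * Self-normalized confidence bounds and growth of the log-determinant *)

Section Confidence.
Variables (R : realType) (d : nat).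
Implicit Types (L M : 'M[R]_d) (b phi theta x u : 'cV[R]_d) (H T B D s : R).

(** An explicit form of the Loewner order: the updates are kept as a list, so comparisons of forms
    and determinants follow one rank-one formula at a time. *)
Definition grows L M := exists us : seq 'cV[R]_d, M = L + \sum_(u <- us) u *m u^T.

Lemma grows_refl L : grows L L.
Proof. by exists [::]; rewrite big_nil addr0. Qed.

Lemma grows_rank1 L M u : grows L M -> grows L (M + u *m u^T).
Proof. by move=> [us ->]; exists (u :: us); rewrite big_cons addrCA addrC. Qed.

Lemma grows_posdef L M : posdef L -> grows L M -> posdef M.
Proof.
move=> pL [us ->]; elim: us => [|u us IH]; first by rewrite big_nil addr0.
by rewrite big_cons addrCA addrC; exact: posdefD_rank1.
Qed.

Lemma grows_bform L M x : grows L M -> bform L x x <= bform M x x.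
Proof.
move=> [us ->]; elim: us => [|u us IH]; first by rewrite big_nil addr0.
rewrite big_cons addrCA addrC bformMD bform_rank1 -expr2.
by rewrite (le_trans IH)// lerDl sqr_ge0.
Qed.

Lemma grows_det L M u : posdef L -> grows L M ->
  \det (L + u *m u^T) <= \det (M + u *m u^T).
Proof.
move=> pL [us ->]; elim: us => [|v us IH]; first by rewrite big_nil addr0.
rewrite big_cons [v *m _ + _]addrC addrA [leRHS](congr1 determinant (addrAC _ _ _)).
have pM : posdef (L + \sum_(w <- us) w *m w^T + u *m u^T).
  by apply/posdefD_rank1/(grows_posdef pL); exists us.
rewrite [leRHS]det_rank1_update//; apply: le_trans IH _; apply: ler_peMr.
  by case/andP: (posdef_det pM) => /ltW.
by rewrite lerDl posdef_ge0//; exact: posdef_inv.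
Qed.

(** The gain is measured in [L], frozen at the start of an epoch, although the update acts on the
    later [M]. By [grows_det] it suffices to treat [L + u *m u^T], whose determinant carries the
    factor 1 + q, and exp(min(1,q)/2) <= 1 + q. *)
Lemma ln_det_growth L M u : posdef L -> grows L M ->
  ln (\det L) + Num.min 1 (bform (invmx L) u u) / 2 <= ln (\det (M + u *m u^T)).
Proof.
move=> pL gM.
have [dL _] := andP (posdef_det pL).
have q0 := posdef_ge0 u (posdef_inv pL).
have [dLu _] := andP (posdef_det (posdefD_rank1 u pL)).
apply: (@le_trans _ _ (ln (\det (L + u *m u^T)))); last first.
  by rewrite ler_ln ?posrE ?grows_det// (lt_le_trans dLu)// grows_det.
rewrite det_rank1_update// lnM ?posrE ?lerD2l//; last lra.
set q := bform _ u u in q0 *.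
rewrite -ler_expR lnK ?posrE; last lra.
have h : 0 <= Num.min 1 q <= 1 by rewrite le_min ler01 q0 ge_min lexx.
by apply: le_trans (expR_half_le h) _; rewrite lerD2l ge_min lexx orbT.
Qed.

(** [posdef_det] is applied to [s^-1 *: L], whose trace is at most d, so the exponential there is at
    most 1. *)
Lemma ln_det_le L s : posdef L -> 0 < s -> \tr L <= d%:R * s ->
  ln (\det L) <= d%:R * ln s.
Proof.
move=> pL s0 trL; have [dL _] := andP (posdef_det pL).
have si : 0 < s^-1 by rewrite invr_gt0.
have /andP[_] := posdef_det (posdefZ si pL).
rewrite detZ mxtraceZ => h.
rewrite mulr_natl -lnXn// ler_ln ?posrE ?exprn_gt0//.
have {h} h : s^-1 ^+ d * \det L <= 1.
  apply: le_trans h _; rewrite -[leRHS]expR0 ler_expR subr_le0 mulrC.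
  by rewrite ler_pdivrMr.
by rewrite exprVn mulrC ler_pdivrMr ?exprn_gt0// mul1r in h.
Qed.

(** For L = I + sum phi phi^T and b = sum phi V(x'), this is sum phi (V(x') - phi.theta), the
    accumulated noise; subtracting the identity removes the regularizer. *)
Definition resid theta L b := b - (L - 1%:M) *m theta.

Definition selfnorm theta H L b : R :=
  expR (bform (invmx L) (resid theta L b) (resid theta L b) / (2 * H ^+ 2))
    / Num.sqrt (\det L).

Lemma selfnorm_ge0 theta H L b : 0 <= selfnorm theta H L b.
Proof. by rewrite divr_ge0 ?expR_ge0 ?sqrtr_ge0. Qed.

Lemma selfnorm_init theta H : selfnorm theta H 1%:M 0 = 1.
Proof.
by rewrite /selfnorm /resid subrr mul0mx subr0 bform0 mul0r expR0 det1 sqrtr1 divr1.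
Qed.

(** Sherman-Morrison gives the new exponent and the determinant gains the factor 1 + u. After
    scaling [v] and [g] by H, the ratio of new to old value is the integrand of
    [self_normalized_step] divided by sqrt(1 + u). *)
Lemma selfnorm_supermartingale (X : finType) (p v : X -> R) theta phi H L b :
  0 < H -> is_distr p -> (forall y, 0 <= v y <= H) ->
  bform 1%:M phi theta = \sum_y p y * v y -> posdef L ->
  \sum_y p y * selfnorm theta H (L + phi *m phi^T) (b + v y *: phi)
    <= selfnorm theta H L b.
Proof.
move=> H0 pd vH mE pL.
set m := \sum_y _ in mE.
have pI := posdef_inv pL.
set u := bform (invmx L) phi phi.
have u0 : 0 <= u by exact: posdef_ge0.
have quadE (x : 'cV[R]_d) (e : R) :
    bform (invmx (L + phi *m phi^T)) (x + e *: phi) (x + e *: phi) =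
    bform (invmx L) x x + (2 * e * bform (invmx L) phi x
      - bform (invmx L) phi x ^+ 2 + e ^+ 2 * u) / (1 + u).
  rewrite sherman_morrison// !(bformDl, bformDr, bformZl, bformZr).
  rewrite (bform_sym x phi pI.1) -/u.
  by field; rewrite gt_eqF//; lra.
set S := resid theta L b.
set g := bform (invmx L) phi S.
have [dL _] := andP (posdef_det pL).
have Hn : H != 0 by rewrite gt_eqF.
(* Because [phi] paired with [theta] is the mean [m], only centered noise is added. *)
have SE y : resid theta (L + phi *m phi^T) (b + v y *: phi) = S + (v y - m) *: phi.
  rewrite /S /resid [L + _ - _]addrAC mulmxDl -mulmxA.
  have -> : phi^T *m theta = m%:M by rewrite [LHS]mx11_scalar -mE /bform mulmx1.
  rewrite mul_mx_scalar scalerBl opprD !addrA; congr (_ - _).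
  by rewrite addrAC.
pose w y := v y / H.
have wE : \sum_y p y * w y = m / H.
  by rewrite /m mulr_suml; apply: eq_bigr => y _; rewrite mulrA.
have w01 y : 0 <= w y <= 1.
  by have /andP[v0 v1] := vH y; rewrite divr_ge0 ?(ltW H0)//= ler_pdivrMr// mul1r.
have qE y : bform (invmx (L + phi *m phi^T)) (S + (v y - m) *: phi) (S + (v y - m) *: phi)
     / (2 * H ^+ 2) = bform (invmx L) S S / (2 * H ^+ 2) +
     (2 * (w y - \sum_y p y * w y) * (g / H) - (g / H) ^+ 2 +
      (w y - \sum_y p y * w y) ^+ 2 * u) / (2 * (1 + u)).
  rewrite wE quadE -/g /w.
  by field; rewrite Hn gt_eqF//; lra.
rewrite (eq_bigr (fun y => (expR (bform (invmx L) S S / (2 * H ^+ 2)) /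
   (Num.sqrt (\det L) * Num.sqrt (1 + u))) *
   (p y * expR ((2 * (w y - \sum_y p y * w y) * (g / H) - (g / H) ^+ 2 +
      (w y - \sum_y p y * w y) ^+ 2 * u) / (2 * (1 + u)))))); last first.
  move=> y _; rewrite /selfnorm SE qE expRD det_rank1_update// -/u.
  by rewrite sqrtrM ?ltW//; ring.
rewrite -mulr_sumr.
have := self_normalized_step pd w01 (g / H) u0.
set W := \sum_y _ => hW.
have su : 0 < Num.sqrt (1 + u) by rewrite sqrtr_gt0; lra.
rewrite /selfnorm -/S [(Num.sqrt _ * _)^-1]invfM mulrA -(mulrA (_ / _)).
apply: ler_piMr; first by rewrite divr_ge0 ?expR_ge0 ?sqrtr_ge0.
by rewrite mulrC ler_pdivrMr ?mul1r.
Qed.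

(** The estimation error is L^-1 (S - theta), with -theta the bias of the unit regularizer. After
    Cauchy-Schwarz in the L^-1 norm, S is controlled by Z <= T and theta by L^-1 <= I, which yields
    the summand [B]. *)
Lemma confidence_width theta H L b D T B phi : 0 < H -> 0 < T -> grows 1%:M L ->
  ln (\det L) <= D -> norm2 theta <= B -> selfnorm theta H L b <= T ->
  `|bform 1%:M phi (invmx L *m b - theta)| <=
    (H * Num.sqrt (2 * (D / 2 + ln T)) + B) * wnorm (invmx L) phi.
Proof.
move=> H0 T0 gL hD hB hT.
have pL : posdef L := grows_posdef (@posdef1 R d) gL.
have pI := posdef_inv pL; have uL := posdef_unit pL.
have [dL _] := andP (posdef_det pL).
set S := resid theta L b.
have -> : bform 1%:M phi (invmx L *m b - theta) = bform (invmx L) phi (S - theta).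
  rewrite /S /resid mulmxBl mul1mx opprB addrA addrAC addrK.
  by rewrite -[invmx L]mul1mx bform_shift mul1mx mulmxBr mulKmx.
rewrite -scaleN1r bformDr bformZr mulN1r.
apply: le_trans (ler_normB _ _) _; rewrite mulrDl.
apply: lerD.
  apply: le_trans (bform_CS _ _ pI) _; rewrite mulrC; apply: ler_wpM2r.
    exact: sqrtr_ge0.
  have -> : H * Num.sqrt (2 * (D / 2 + ln T)) = Num.sqrt (H ^+ 2 * (2 * (D / 2 + ln T))).
    by rewrite [RHS]sqrtrM ?sqr_ge0// sqrtr_sqr ger0_norm// ltW.
  apply: ler_wsqrtr.
  (* Logarithms turn Z <= T into |S|^2 / (2 H^2) <= ln T + ln (det L) / 2. *)
  move: hT; rewrite /selfnorm -/S ler_pdivrMr ?sqrtr_gt0//.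
  have -> : Num.sqrt (\det L) = expR (ln (\det L) / 2).
    apply/eqP; rewrite -(@eqrXn2 _ 2) ?sqrtr_ge0 ?expR_ge0//.
    rewrite sqr_sqrtr ?ltW// -expRM_natl.
    by rewrite mulrC divfK ?pnatr_eq0// lnK ?posrE.
  rewrite -{1}[T]lnK ?posrE// -expRD ler_expR ler_pdivrMr; last first.
    by rewrite mulr_gt0// exprn_gt0.
  move=> h; apply: le_trans h _.
  have -> : H ^+ 2 * (2 * (D / 2 + ln T)) = (ln T + D / 2) * (2 * H ^+ 2) by ring.
  apply: ler_wpM2r; first by rewrite mulr_ge0// sqr_ge0.
  lra.
apply: le_trans (bform_CS _ _ pI) _; rewrite mulrC; apply: ler_wpM2r.
  exact: sqrtr_ge0.
apply: le_trans _ hB; apply: ler_wsqrtr.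
apply: le_trans (posdef_inv_le1 _ pL (fun v => grows_bform v gL)) _.
by rewrite bform1E.
Qed.

End Confidence.

(** * Discounted occupancy measures and their flow equation *)

Section Occupancy.
Variables (R : realType) (X A : finType) (P : X -> A -> X -> R) (gamma : R).
Hypotheses (kP : is_kernel P) (g01 : 0 < gamma < 1).
Implicit Types (nu : X -> R) (pi : X -> A -> R) (f : X -> A -> R).

Definition trans pi x y : R := \sum_a pi x a * P x a y.

Lemma trans_ge0 pi x y : is_policy pi -> 0 <= trans pi x y.
Proof.
by move=> ppi; apply: sumr_ge0 => a _; rewrite mulr_ge0 ?(ppi x).1 ?(kP x a).1.
Qed.

Lemma trans_mean pi x (V : X -> R) :
  \sum_y trans pi x y * V y = \sum_a pi x a * \sum_y P x a y * V y.
Proof.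
under eq_bigr do rewrite mulr_suml.
rewrite exchange_big/=; apply: eq_bigr => a _.
by rewrite mulr_sumr; apply: eq_bigr => y _; rewrite mulrA.
Qed.

Lemma trans_sum1 pi x : is_policy pi -> \sum_y trans pi x y = 1.
Proof.
move=> ppi; rewrite exchange_big/= -(ppi x).2; apply: eq_bigr => a _.
by rewrite -mulr_sumr (kP x a).2 mulr1.
Qed.

Section Flow.
Variables (nu : X -> R) (pi : X -> A -> R).
Hypotheses (dnu : is_distr nu) (ppi : is_policy pi).

Lemma state_law_distr t : is_distr (state_law P nu pi t).
Proof.
elim: t => [//|t [IH0 IH1]]; split=> [y|] /=.
  by apply: sumr_ge0 => x _; rewrite mulr_ge0//; exact: trans_ge0.
rewrite exchange_big/= -IH1; apply: eq_bigr => x _.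
by rewrite -mulr_sumr trans_sum1// mulr1.
Qed.

Let s x n : R := \sum_(t < n) gamma ^+ t * state_law P nu pi t x.

Let s_cvg x : cvgn (s x).
Proof.
have [g0 g1] := andP g01.
have law01 t : 0 <= state_law P nu pi t x <= 1.
  have [h0 h1] := state_law_distr t; rewrite h0/= -h1 (bigD1 x)//= lerDl.
  by apply: sumr_ge0 => y _; exact: h0.
apply: nondecreasing_is_cvgn.
  apply/nondecreasing_seqP => n; rewrite /s big_ord_recr/= lerDl.
  by rewrite mulr_ge0 ?exprn_ge0 ?(ltW g0)//; case/andP: (law01 n).
exists (1 - gamma)^-1 => _ [n _ <-].
apply: (@le_trans _ _ (\sum_(t < n) gamma ^+ t)).
  apply: ler_sum => t _; apply: ler_piMr; first by rewrite exprn_ge0// ltW.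
  by case/andP: (law01 t).
rewrite -[leRHS]mul1r ler_pdivlMr; last lra.
have := subrX1 gamma n => h.
have : 0 <= gamma ^+ n by rewrite exprn_ge0// ltW.
lra.
Qed.

Let s_rec y n : s y n.+1 = nu y + gamma * \sum_x s x n * trans pi x y.
Proof.
rewrite /s big_ord_recl/= expr0 mul1r; congr (_ + _).
under [X in _ = gamma * X]eq_bigr do rewrite mulr_suml.
rewrite exchange_big/= mulr_sumr; apply: eq_bigr => t _.
rewrite /bump/= add1n exprS/= -mulrA; congr (_ * _).
rewrite mulr_sumr; apply: eq_bigr => x _; by rewrite mulrA.
Qed.

Lemma state_occ_ge0 x : 0 <= state_occ P gamma nu pi x.
Proof.
have [g0 g1] := andP g01.
apply: mulr_ge0; first lra.
apply: limr_ge; first exact: s_cvg.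
apply: nearW => n; apply: sumr_ge0 => t _.
by rewrite mulr_ge0 ?exprn_ge0 ?(ltW g0)//; case: (state_law_distr t).
Qed.

(** Limit of the recursion [s_rec] for partial sums. Later arguments use this equation and
    positivity, without returning to the limit. *)
Lemma state_occ_flow y : state_occ P gamma nu pi y =
  (1 - gamma) * nu y + gamma * \sum_x state_occ P gamma nu pi x * trans pi x y.
Proof.
have h : limn (s y) = nu y + gamma * \sum_x limn (s x) * trans pi x y.
  have c1 : ((fun n => s y n.+1) @ \oo --> limn (s y))%classic.
    by rewrite (cvg_shiftS (s y)); exact: s_cvg.
  have c2 : ((fun n => s y n.+1) @ \oo -->
      (nu y + gamma * \sum_x limn (s x) * trans pi x y)%R)%classic.
    under eq_fun do rewrite s_rec.
    apply: cvgD; first exact: cvg_cst.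
    apply: cvgMl_tmp.
    apply: cvg_big => [|x _]; first exact: add_continuous.
    by apply: cvgMr_tmp; exact: s_cvg.
  exact: (cvg_unique (@Rhausdorff R) c1 c2).
rewrite {1}/state_occ -/(s y) h mulrDr mulrCA; congr (_ + _ * _).
by rewrite mulr_sumr; apply: eq_bigr => x _; rewrite mulrA.
Qed.

Lemma state_occ_sum1 : \sum_x state_occ P gamma nu pi x = 1.
Proof.
have [g0 g1] := andP g01.
move: (state_occ P gamma nu pi) state_occ_flow => o fl.
have : \sum_x o x = (1 - gamma) + gamma * \sum_x o x.
  under [LHS]eq_bigr do rewrite fl.
  rewrite big_split/= -!mulr_sumr dnu.2 mulr1; congr (_ + _ * _).
  rewrite exchange_big/=; apply: eq_bigr => x _.
  by rewrite -mulr_sumr trans_sum1// mulr1.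
nra.
Qed.

End Flow.

(** A stochastic kernel does not increase the l1 norm, so |D| <= |E| + gamma |D|. For E = 0 this is
    uniqueness; for small E it is stability of occupancies under a change of policy. *)
Lemma flow_l1_bound pi (D E : X -> R) : is_policy pi ->
  (forall y, D y = E y + gamma * \sum_x D x * trans pi x y) ->
  \sum_x `|D x| <= (1 - gamma)^-1 * \sum_x `|E x|.
Proof.
have [g0 g1] := andP g01.
move=> ppi h; rewrite mulrC ler_pdivlMr; last lra.
suff : \sum_x `|D x| <= \sum_x `|E x| + gamma * \sum_x `|D x| by lra.
have -> : \sum_x `|D x| = \sum_x \sum_y `|D x| * trans pi x y.
  by apply: eq_bigr => x _; rewrite -mulr_sumr trans_sum1// mulr1.
rewrite [X in gamma * X]exchange_big/=.
under eq_bigr do rewrite -mulr_sumr trans_sum1// mulr1.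
rewrite mulr_sumr -big_split/=; apply: ler_sum => y _.
rewrite {1}h; apply: le_trans (ler_normD _ _) _; rewrite lerD2l.
rewrite normrM (ger0_norm (ltW g0)) ler_pM2l//.
apply: le_trans (ler_norm_sum _ _ _) _; apply: ler_sum => x _.
by rewrite normrM (ger0_norm (trans_ge0 x y ppi)).
Qed.

Lemma flow_unique pi nu (o : X -> R) : is_policy pi -> is_distr nu ->
  (forall y, o y = (1 - gamma) * nu y + gamma * \sum_x o x * trans pi x y) ->
  o =1 state_occ P gamma nu pi.
Proof.
move=> ppi dnu h x.
have /(flow_l1_bound ppi) : forall y, (o y - state_occ P gamma nu pi y) =
    0 + gamma * \sum_x (o x - state_occ P gamma nu pi x) * trans pi x y.
  move=> y; rewrite h (state_occ_flow dnu ppi) add0r.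
  under [in RHS]eq_bigr do rewrite mulrBl.
  by rewrite sumrB; ring.
rewrite [X in _ * X]big1 ?mulr0 => [h0|z _]; last exact: normr0.
apply/eqP; rewrite -subr_eq0 -normr_le0; apply: le_trans h0.
by rewrite (bigD1 x)//= lerDl; apply: sumr_ge0.
Qed.

Lemma dirac_distr (x : X) : is_distr (Defs.dirac R x).
Proof.
split=> [y|]; first exact: ler0n.
by rewrite /Defs.dirac (bigD1 x)//= eqxx big1 ?addr0// => y /negbTE ->.
Qed.

Lemma mean_dirac (x : X) (F : X -> R) : \sum_z F z * Defs.dirac R z x = F x.
Proof.
rewrite /Defs.dirac (bigD1 x)//= eqxx mulr1 big1 ?addr0// => y.
by rewrite eq_sym => /negbTE ->; rewrite mulr0.
Qed.

Section Mixture.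
Variable pi : X -> A -> R.
Hypothesis ppi : is_policy pi.

(** The occupancies are hidden behind an opaque [o], so that rewriting sees only the flow
    equation. *)
Lemma state_occ_table : exists2 o : X -> X -> R,
  forall z x, state_occ P gamma (Defs.dirac R z) pi x = o z x &
  forall z y, o z y = (1 - gamma) * Defs.dirac R z y +
                      gamma * \sum_x o z x * trans pi x y.
Proof.
exists (fun z => state_occ P gamma (Defs.dirac R z) pi) => // z y.
exact: (state_occ_flow (dirac_distr z) ppi).
Qed.

Lemma state_occ_mix nu x : is_distr nu ->
  state_occ P gamma nu pi x = \sum_z nu z * state_occ P gamma (Defs.dirac R z) pi x.
Proof.
move=> dnu; have [tab oE fl] := state_occ_table.
under eq_bigr do rewrite oE.
apply/esym; move: x; apply: flow_unique => // y.
under eq_bigr do rewrite fl mulrDr mulrCA (mulrCA (nu _) gamma).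
rewrite big_split/= -!mulr_sumr mean_dirac; congr (_ + _ * _).
under [LHS]eq_bigr do rewrite mulr_sumr.
rewrite [LHS]exchange_big/=; apply: eq_bigr => x _.
by rewrite mulr_suml; apply: eq_bigr => z _; rewrite mulrA.
Qed.

(** The flow equation conditions on the last transition, this one on the first. The right side
    solves the flow equation started at [x], so uniqueness applies. *)
Lemma state_occ_backward x y :
  state_occ P gamma (Defs.dirac R x) pi y = (1 - gamma) * Defs.dirac R x y +
    gamma * \sum_z trans pi x z * state_occ P gamma (Defs.dirac R z) pi y.
Proof.
have [tab oE fl] := state_occ_table.
under eq_bigr do rewrite oE.
apply/esym; move: y; apply: flow_unique => // [|y].
  exact: dirac_distr.
congr (_ + _ * _).
under eq_bigr do rewrite fl mulrDr mulrCA (mulrCA (trans _ _ _) gamma).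
rewrite big_split/= -!mulr_sumr mean_dirac.
under [RHS]eq_bigr do rewrite mulrDl.
rewrite big_split/=; congr (_ + _).
  under [RHS]eq_bigr => w _ do rewrite -mulrA.
  rewrite -mulr_sumr; congr (_ * _).
  rewrite /Defs.dirac (bigD1 x)//= eqxx mul1r big1 ?addr0// => w /negbTE ->.
  by rewrite mul0r.
under [RHS]eq_bigr do rewrite -mulrA.
rewrite -[RHS]mulr_sumr; congr (_ * _).
under [LHS]eq_bigr do rewrite mulr_sumr.
rewrite [LHS]exchange_big/=; apply: eq_bigr => w _.
by rewrite mulr_suml; apply: eq_bigr => z _; rewrite mulrA.
Qed.

End Mixture.

Section OccDot.
Variables (nu : X -> R) (pi : X -> A -> R).
Hypotheses (dnu : is_distr nu) (ppi : is_policy pi).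
Local Notation occ := (occ_dot P gamma nu pi).

Lemma occ_dotE f : occ f = \sum_x state_occ P gamma nu pi x * \sum_a pi x a * f x a.
Proof.
by apply: eq_bigr => x _; rewrite mulr_sumr; apply: eq_bigr => a _; rewrite mulrA.
Qed.

Lemma occ_dot_state (V : X -> R) :
  occ (fun x _ => V x) = \sum_x state_occ P gamma nu pi x * V x.
Proof.
by rewrite occ_dotE; apply: eq_bigr => x _; rewrite -mulr_suml (ppi x).2 mul1r.
Qed.

Lemma occ_dot_le f1 f2 : (forall x a, f1 x a <= f2 x a) -> occ f1 <= occ f2.
Proof.
move=> h; apply: ler_sum => x _; apply: ler_sum => a _; apply: ler_wpM2l => //.
by rewrite mulr_ge0 ?state_occ_ge0 ?(ppi x).1.
Qed.

Lemma occ_dot_const (c : R) : occ (fun _ _ => c) = c.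
Proof. by rewrite (occ_dot_state (fun=> c)) -mulr_suml state_occ_sum1// mul1r. Qed.

Lemma occ_dotD f1 f2 : occ (fun x a => f1 x a + f2 x a) = occ f1 + occ f2.
Proof.
rewrite -big_split/=; apply: eq_bigr => x _; rewrite -big_split/=.
by apply: eq_bigr => a _; rewrite mulrDr.
Qed.

Lemma occ_dotZ c f : occ (fun x a => c * f x a) = c * occ f.
Proof.
rewrite mulr_sumr; apply: eq_bigr => x _; rewrite mulr_sumr.
by apply: eq_bigr => a _; rewrite mulrCA.
Qed.

Lemma occ_dotB f1 f2 : occ (fun x a => f1 x a - f2 x a) = occ f1 - occ f2.
Proof.
rewrite -[- occ f2]mulN1r -occ_dotZ -occ_dotD.
by apply: eq_bigr => x _; apply: eq_bigr => a _; rewrite mulN1r.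
Qed.

(** The flow equation tested against [V]: a discounted transition returns the occupancy measure
    minus the fresh mass [(1 - gamma) * nu]. *)
Lemma occ_dot_bellman (V : X -> R) :
  occ (fun x a => gamma * \sum_y P x a y * V y) =
  occ (fun x _ => V x) - (1 - gamma) * \sum_x nu x * V x.
Proof.
rewrite occ_dot_state.
under [X in _ = X - _]eq_bigr do rewrite (state_occ_flow dnu ppi) mulrDl.
rewrite big_split/=.
have -> : \sum_x (1 - gamma) * nu x * V x = (1 - gamma) * \sum_x nu x * V x.
  by rewrite mulr_sumr; apply: eq_bigr => x _; rewrite mulrA.
rewrite [_ + _ - _]addrAC subrr add0r occ_dotZ occ_dotE.
under [RHS]eq_bigr do rewrite -mulrA mulr_suml.
rewrite -mulr_sumr exchange_big/=; congr (_ * _); apply: eq_bigr => x _.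
rewrite -trans_mean mulr_sumr; apply: eq_bigr => y _; by rewrite mulrA.
Qed.

End OccDot.

Lemma occ_dot_mix pi nu f : is_policy pi -> is_distr nu ->
  occ_dot P gamma nu pi f = \sum_z nu z * occ_dot P gamma (Defs.dirac R z) pi f.
Proof.
move=> ppi dnu; rewrite occ_dotE.
under eq_bigr do rewrite (state_occ_mix ppi _ dnu) mulr_suml.
rewrite exchange_big/=; apply: eq_bigr => z _.
by rewrite occ_dotE mulr_sumr; apply: eq_bigr => x _; rewrite mulrA.
Qed.

(** It mirrors one round of [exp_regret], stopping with probability 1 - gamma and moving on
    otherwise, and so tracks an end-of-epoch expectation round by round. *)
Lemma occ_dot_dirac pi f x : is_policy pi ->
  occ_dot P gamma (Defs.dirac R x) pi f = \sum_a pi x a * ((1 - gamma) * f x a +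
    gamma * \sum_y P x a y * occ_dot P gamma (Defs.dirac R y) pi f).
Proof.
move=> ppi; rewrite occ_dotE.
under eq_bigr do rewrite (state_occ_backward ppi) mulrDl.
rewrite big_split/=.
have -> : \sum_z (1 - gamma) * Defs.dirac R x z * (\sum_a pi z a * f z a) =
    (1 - gamma) * \sum_a pi x a * f x a.
  rewrite (bigD1 x)//= [X in _ + X]big1 => [|z /negbTE zx].
    by rewrite /Defs.dirac eqxx mulr1 addr0.
  by rewrite /Defs.dirac zx mulr0 mul0r.
have -> : \sum_z gamma * (\sum_w trans pi x w * state_occ P gamma (Defs.dirac R w) pi z) *
    (\sum_a pi z a * f z a) =
    gamma * \sum_w trans pi x w * occ_dot P gamma (Defs.dirac R w) pi f.
  under eq_bigr do rewrite -mulrA mulr_suml.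
  rewrite -mulr_sumr exchange_big/=; congr (_ * _); apply: eq_bigr => w _.
  by rewrite occ_dotE mulr_sumr; apply: eq_bigr => z _; rewrite mulrA.
rewrite trans_mean !mulr_sumr -big_split/=; apply: eq_bigr => a _.
by rewrite mulrDr mulrCA (mulrCA gamma).
Qed.

(** Optimality is stated from single states; it passes to [nu] because occupancies are linear in the
    initial distribution. *)
Lemma optimal_gap_ge0 (r pis pi : X -> A -> R) nu : optimal_policy P gamma r pis ->
  is_distr nu -> is_policy pi -> 0 <= gap P gamma r nu pis pi.
Proof.
move=> [ppis opt] dnu ppi; rewrite subr_ge0 !(@occ_dot_mix _ nu)//.
by apply: ler_sum => z _; rewrite ler_wpM2l ?dnu.1// opt.
Qed.

End Occupancy.

(** * The softmax policy update *)

Section Softmax.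
Variables (R : realType) (X A : finType) (eta H : R) (pi Q : X -> A -> R).
Hypotheses (eta0 : 0 < eta) (ppi : is_policy pi)
  (pi0 : forall x a, 0 < pi x a) (Q0H : forall x a, 0 <= Q x a <= H).
Local Notation V := (softV eta pi Q).

Lemma policy_distr x : is_distr (pi x).
Proof. by case: (ppi x). Qed.

Lemma policy_le1 x a : pi x a <= 1.
Proof.
case: (ppi x) => h0 <-; rewrite (bigD1 a)//= lerDl.
by apply: sumr_ge0 => b _; exact: h0.
Qed.

Lemma softV_sum_bounds x : 1 <= \sum_a pi x a * expR (eta * Q x a) <= expR (eta * H).
Proof.
have h a : 1 <= expR (eta * Q x a) <= expR (eta * H).
  case/andP: (Q0H x a) => q0 q1.
  by rewrite -{1}expR0 !ler_expR mulr_ge0 ?(ltW eta0)//= ler_pM2l.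
have h1 := distr_mean_le (policy_distr x) (fun a => (andP (h a)).1).
have h2 := distr_mean_le (policy_distr x) (fun a => (andP (h a)).2).
rewrite (distr_mean_const (policy_distr x)) in h1.
rewrite (distr_mean_const (policy_distr x)) in h2.
by rewrite h1.
Qed.

Lemma softV_sum_gt0 x : 0 < \sum_a pi x a * expR (eta * Q x a).
Proof. by case/andP: (softV_sum_bounds x) => h _; apply: lt_le_trans h. Qed.

Lemma softV_bounds x : 0 <= V x <= H.
Proof.
case/andP: (softV_sum_bounds x) => h1 h2; apply/andP; split.
  by rewrite mulr_ge0 ?invr_ge0 ?(ltW eta0) ?ln_ge0.
rewrite /softV mulrC ler_pdivrMr// [H * eta]mulrC -[leRHS]expRK ler_ln ?posrE ?expR_gt0//.
exact: softV_sum_gt0.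
Qed.

Lemma newpi_gt0 x a : 0 < newpi eta pi Q x a.
Proof. by rewrite mulr_gt0 ?expR_gt0. Qed.

Lemma newpi_policy : is_policy (newpi eta pi Q).
Proof.
move=> x; split=> [a|]; first exact/ltW/newpi_gt0.
have E : expR (eta * V x) = \sum_a pi x a * expR (eta * Q x a).
  by rewrite /softV mulrA divff ?gt_eqF// mul1r lnK ?posrE ?softV_sum_gt0.
rewrite /newpi; under eq_bigr do rewrite mulrBr expRB mulrA.
by rewrite -mulr_suml -E divff// expR_eq0.
Qed.

(** Written through a difference of log-policies, [Q] can telescope over epochs once averaged under
    the fixed occupancy measure of the comparator. *)
Lemma newpi_ln x a : Q x a = V x + eta^-1 * (ln (newpi eta pi Q x a) - ln (pi x a)).
Proof.
rewrite /newpi lnM ?posrE ?expR_gt0// expRK [ln _ + _]addrC addrK.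
by rewrite mulrA mulVf ?gt_eqF// mul1r addrC subrK.
Qed.

Hypothesis etaH : eta * H <= 2^-1.

(** With z = eta Q at most 1/2, one has exp z <= 1 + z + 2 z^2, and then ln (1 + y) <= y; the
    quadratic term is the excess of the soft maximum over the mean. *)
Lemma softV_le_mean x : V x <= \sum_a pi x a * Q x a + 2 * eta * H ^+ 2.
Proof.
set m := \sum_a _.
rewrite /softV mulrC ler_pdivrMr//.
have h a : expR (eta * Q x a) <= 1 + (eta * Q x a + 2 * (eta * H) ^+ 2).
  case/andP: (Q0H x a) => q0 q1.
  have hq : 0 <= eta * Q x a by rewrite mulr_ge0// ltW.
  have hqH : eta * Q x a <= eta * H by rewrite ler_pM2l.
  have : `|eta * Q x a| <= 2^-1 by rewrite ger0_norm// (le_trans hqH).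
  move=> /expR_quad_le; nra.
have := distr_mean_le (policy_distr x) h.
have -> : \sum_a pi x a * (1 + (eta * Q x a + 2 * (eta * H) ^+ 2)) =
   1 + (eta * m + 2 * (eta * H) ^+ 2).
  transitivity (\sum_a pi x a * 1 + (eta * m + \sum_a pi x a * (2 * (eta * H) ^+ 2))).
    rewrite /m mulr_sumr -!big_split/=; apply: eq_bigr => a _; ring.
  by rewrite !(distr_mean_const (policy_distr x)).
move=> hs.
have s0 := softV_sum_gt0 x.
apply: (@le_trans _ _ (ln (1 + (eta * m + 2 * (eta * H) ^+ 2)))).
  by rewrite ler_ln ?posrE//; apply: lt_le_trans hs.
apply: le_trans (le_ln1Dx _) _; first lra.
by rewrite le_eqVlt; apply/orP; left; apply/eqP; ring.
Qed.

Lemma newpi_l1_le x : \sum_a `|newpi eta pi Q x a - pi x a| <= 2 * (eta * H).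
Proof.
rewrite -(distr_mean_const (policy_distr x) (2 * (eta * H))).
apply: ler_sum => a _.
have -> : newpi eta pi Q x a - pi x a = pi x a * (expR (eta * (Q x a - V x)) - 1).
  by rewrite /newpi; ring.
rewrite normrM gtr0_norm// ler_pM2l//; apply: expR_sub1_le => //.
rewrite normrM gtr0_norm// ler_pM2l// ler_norml.
case/andP: (Q0H x a) => q0 q1; case/andP: (softV_bounds x) => v0 v1.
by apply/andP; split; lra.
Qed.

End Softmax.

(** * Decomposition of the gap of one policy along the potential *)

Section GapDecomposition.
Variables (R : realType) (X A : finType) (P : X -> A -> X -> R) (gamma : R).
Hypotheses (kP : is_kernel P) (g01 : 0 < gamma < 1).
Variables (nu0 : X -> R) (r pis : X -> A -> R) (eta : R).
Hypotheses (dnu : is_distr nu0) (ppis : is_policy pis) (eta0 : 0 < eta).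
Local Notation H := (1 - gamma)^-1.
Local Notation occ := (occ_dot P gamma nu0).

(** Subtracting the two flow equations leaves a source [E] of l1 mass at most 2 eta H by
    [newpi_l1_le]. [flow_l1_bound] costs one factor H, the size of [V] another. *)
Lemma occ_newpi_perturb (pi Q : X -> A -> R) (V : X -> R) :
  is_policy pi -> (forall x a, 0 < pi x a) -> (forall x a, 0 <= Q x a <= H) ->
  (forall x, 0 <= V x <= H) -> eta * H <= 2^-1 ->
  occ (newpi eta pi Q) (fun x _ => V x) - occ pi (fun x _ => V x) <= 2 * eta * H ^+ 3.
Proof.
move=> ppi pi0 QH VH etaH.
have [g0 g1] := andP g01.
have H0 : 0 < H by rewrite invr_gt0; lra.
have ppi2 := newpi_policy eta0 ppi pi0 QH.
set pi2 := newpi eta pi Q in ppi2 *.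
rewrite !occ_dot_state//.
have fl1 := state_occ_flow kP g01 dnu ppi.
have fl2 := state_occ_flow kP g01 dnu ppi2.
have s1 := state_occ_sum1 kP g01 dnu ppi.
have o1 := state_occ_ge0 kP g01 dnu ppi.
move: (state_occ P gamma nu0 pi) fl1 s1 o1 => m1 fl1 s1 o1.
move: (state_occ P gamma nu0 pi2) fl2 => m2 fl2.
pose E y := gamma * \sum_x m1 x * (trans P pi2 x y - trans P pi x y).
have DE y : m2 y - m1 y = E y + gamma * \sum_x (m2 x - m1 x) * trans P pi2 x y.
  rewrite fl1 fl2 /E opprD addrACA subrr add0r -mulrBr -mulrDr; congr (_ * _).
  by rewrite -sumrB -big_split/=; apply: eq_bigr => x _; ring.
have El1 : \sum_y `|E y| <= 2 * (eta * H).
  apply: (@le_trans _ _ (\sum_y \sum_x m1 x * `|trans P pi2 x y - trans P pi x y|)).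
    apply: ler_sum => y _; rewrite /E normrM gtr0_norm//.
    apply: le_trans (ler_piMl _ (ltW g1)) _ => //.
    apply: le_trans (ler_norm_sum _ _ _) _; apply: ler_sum => x _.
    by rewrite normrM ger0_norm.
  rewrite exchange_big/= -(distr_mean_const (conj o1 s1) (2 * (eta * H))).
  apply: ler_sum => x _; rewrite -mulr_sumr; apply: ler_wpM2l => //.
  apply: le_trans _ (newpi_l1_le eta0 ppi pi0 QH etaH x).
  apply: (@le_trans _ _ (\sum_y \sum_a `|pi2 x a - pi x a| * P x a y)).
    apply: ler_sum => y _; rewrite /trans -sumrB.
    apply: le_trans (ler_norm_sum _ _ _) _; apply: ler_sum => a _.
    by rewrite -mulrBl normrM (ger0_norm ((kP x a).1 y)).
  rewrite exchange_big/=; apply: ler_sum => a _.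
  by rewrite -mulr_sumr (kP x a).2 mulr1.
have D1 := flow_l1_bound kP g01 ppi2 DE.
rewrite -sumrB.
apply: (@le_trans _ _ (\sum_x `|m2 x - m1 x| * H)).
  apply: ler_sum => x _; rewrite -mulrBl.
  case/andP: (VH x) => v0 v1.
  apply: le_trans (ler_norm _) _; rewrite normrM (ger0_norm v0).
  exact: ler_wpM2l.
rewrite -mulr_suml.
have -> : 2 * eta * H ^+ 3 = H * (2 * (eta * H)) * H by ring.
apply: ler_wpM2r; first exact: ltW.
by apply: le_trans D1 _; apply: ler_wpM2l => //; exact: ltW.
Qed.

Definition potential (pi : X -> A -> R) (V : X -> R) : R :=
  occ pi (fun x _ => V x) - occ pis (fun x _ => V x)
    - eta^-1 * occ pis (fun x a => ln (pi x a)).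

(** The lower bound on [Q] is averaged under the occupancy of [pis], the upper bound under that of
    [pi]; by [occ_dot_bellman] the initial terms cancel. Then [newpi_ln] rewrites the first average
    of [Q], [softV_le_mean] bounds the second, and [occ_newpi_perturb] passes from [pi] to the
    updated policy. *)
Lemma gap_decomposition (pi Q m : X -> A -> R) (V : X -> R) :
  is_policy pi -> (forall x a, 0 < pi x a) -> (forall x a, 0 <= Q x a <= H) ->
  eta * H <= 2^-1 ->
  (forall x a, r x a + gamma * \sum_y P x a y * V y <= Q x a) ->
  (forall x a, Q x a <= r x a + gamma * \sum_y P x a y * V y + m x a) ->
  gap P gamma r nu0 pis pi <=
    potential pi V - potential (newpi eta pi Q) (softV eta pi Q)
      + (2 * eta * H ^+ 2 + 2 * eta * H ^+ 3) + occ pi m.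
Proof.
move=> ppi pi0 QH etaH opt pes.
have [g0 g1] := andP g01.
have H0 : 0 < H by rewrite invr_gt0; lra.
set V2 := softV eta pi Q; set pi2 := newpi eta pi Q.
have VH := softV_bounds eta0 ppi QH.
have pert := occ_newpi_perturb ppi pi0 QH VH etaH.
rewrite -/pi2 -/V2 in pert.
have a1 := occ_dot_le kP g01 dnu ppis opt.
rewrite occ_dotD (occ_dot_bellman kP g01 dnu ppis) in a1.
have a2 := occ_dot_le kP g01 dnu ppi pes.
rewrite !occ_dotD (occ_dot_bellman kP g01 dnu ppi) in a2.
have a3 : occ pis Q = occ pis (fun x _ => V2 x) +
    eta^-1 * (occ pis (fun x a => ln (pi2 x a)) - occ pis (fun x a => ln (pi x a))).
  rewrite -occ_dotB -occ_dotZ -occ_dotD.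
  apply: eq_bigr => x _; apply: eq_bigr => a _.
  by rewrite {1}(newpi_ln Q eta0 pi0).
have a4 : occ pi (fun x _ => V2 x) <= occ pi Q + 2 * eta * H ^+ 2.
  rewrite -(occ_dot_const kP g01 dnu ppi (2 * eta * H ^+ 2)) occ_dot_state//.
  rewrite (occ_dot_state _ _ _ ppi (fun=> 2 * eta * H ^+ 2)) occ_dotE -big_split/=.
  apply: ler_sum => x _; rewrite -mulrDr; apply: ler_wpM2l.
    exact: state_occ_ge0.
  exact: (softV_le_mean eta0 ppi QH etaH).
rewrite /gap /potential; lra.
Qed.

Lemma gap_le1 pi : is_policy pi -> (forall x a, 0 <= r x a <= 1) ->
  gap P gamma r nu0 pis pi <= 1.
Proof.
move=> ppi r01; rewrite /gap.
have h1 : occ pis r <= 1.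
  rewrite -[leRHS](occ_dot_const kP g01 dnu ppis 1); apply: occ_dot_le => // x a.
  by case/andP: (r01 x a).
have h2 : 0 <= occ pi r.
  rewrite -[leLHS](occ_dot_const kP g01 dnu ppi 0); apply: occ_dot_le => // x a.
  by case/andP: (r01 x a).
lra.
Qed.

Lemma potential_ge pi (V : X -> R) : is_policy pi -> (forall x, 0 <= V x <= H) ->
  - H <= potential pi V.
Proof.
move=> ppi VH; rewrite /potential.
have h1 : 0 <= occ pi (fun x _ => V x).
  rewrite -[leLHS](occ_dot_const kP g01 dnu ppi 0); apply: occ_dot_le => // x a.
  by case/andP: (VH x).
have h2 : occ pis (fun x _ => V x) <= H.
  rewrite -[leRHS](occ_dot_const kP g01 dnu ppis H); apply: occ_dot_le => // x a.
  by case/andP: (VH x).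
have h3 : occ pis (fun x a => ln (pi x a)) <= 0.
  rewrite -[leRHS](occ_dot_const kP g01 dnu ppis 0); apply: occ_dot_le => // x a.
  by apply: ln_le0; exact: policy_le1.
have h4 : eta^-1 * occ pis (fun x a => ln (pi x a)) <= 0.
  by rewrite pmulr_rle0 ?invr_gt0.
lra.
Qed.

End GapDecomposition.

(** * Inductive regret bound over rounds and epochs *)

Section Regret.
Variables (R : realType) (X A : finType) (d : nat) (P : X -> A -> X -> R) (gamma : R)
  (psi : X -> A -> X -> 'cV[R]_d) (theta : 'cV[R]_d) (B : R)
  (r : X -> A -> R) (nu0 : X -> R) (pis : X -> A -> R) (T : nat) (eta beta c D : R).
Local Notation H := (1 - gamma)^-1.
Hypotheses (T0 : (0 < T)%N) (g01 : 0 < gamma < 1) (r01 : forall x a, 0 <= r x a <= 1)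
  (dnu : is_distr nu0) (kP : is_kernel P)
  (mix : forall x a y, P x a y = \sum_i theta i ord0 * psi x a y i ord0)
  (thetaB : norm2 theta <= B)
  (featB : forall x a (V : X -> R), (forall y, 0 <= V y <= H) ->
     norm2 (\sum_y V y *: psi x a y) <= B * H)
  (opt : optimal_policy P gamma r pis)
  (eta0 : 0 < eta) (etaH : eta * H <= 2^-1) (c0 : 0 < c)
  (betaE : beta = H * Num.sqrt (2 * (D / 2 + ln (T%:R : R))) + B)
  (Hbeta : H <= beta)
  (detD : forall L : 'M[R]_d, posdef L ->
     \tr L <= d%:R + T%:R * (B * H) ^+ 2 -> ln (\det L) <= D).

Let nQ := newQ gamma psi r beta H.
Let regret := exp_regret P gamma psi r nu0 eta beta H pis.
Let Psi := potential P gamma nu0 pis eta.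
Let Z := selfnorm theta H.

Definition soft_policy (pi : X -> A -> R) := is_policy pi /\ forall x a, 0 < pi x a.

Let gpos : 0 < gamma. Proof. by case/andP: g01. Qed.
Let glt1 : gamma < 1. Proof. by case/andP: g01. Qed.
Let H0 : 0 < H. Proof. by rewrite invr_gt0 subr_gt0. Qed.
Let HE : H = 1 + gamma * H.
Proof. by field; rewrite subr_eq0 gt_eqF. Qed.
Let beta0 : 0 < beta. Proof. exact: lt_le_trans Hbeta. Qed.

Lemma newQ_bounds L b V x a : 0 <= nQ L b V x a <= H.
Proof. by rewrite /nQ /newQ /clipH le_max lexx orbT/= ge_max (ltW H0) ge_min lexx orbT. Qed.

Lemma feat_mean V x a : bform 1%:M (feat psi V x a) theta = \sum_y P x a y * V y.
Proof.
rewrite bform1E /feat.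
under eq_bigr do rewrite summxE mulr_suml.
rewrite exchange_big/=; apply: eq_bigr => y _.
rewrite mix mulr_suml; apply: eq_bigr => i _.
by rewrite mxE; ring.
Qed.

Lemma feat_tr V x a : (forall y, 0 <= V y <= H) ->
  \tr (feat psi V x a *m (feat psi V x a)^T) <= (B * H) ^+ 2.
Proof.
move=> /(featB x a) h; rewrite tr_rank1 bform1E.
set v := feat psi V x a; rewrite -/(feat psi V x a) -/v /norm2 in h.
have s0 : 0 <= \sum_i v i ord0 ^+ 2 by apply: sumr_ge0 => i _; exact: sqr_ge0.
rewrite -[leLHS](sqr_sqrtr s0).
by rewrite lerXn2r ?nnegrE ?sqrtr_ge0// (le_trans _ h)// sqrtr_ge0.
Qed.

Section Optimism.
Variables (L : 'M[R]_d) (b : 'cV[R]_d) (V : X -> R).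
Hypotheses (gL : grows 1%:M L) (trL : \tr L <= d%:R + T%:R * (B * H) ^+ 2)
  (good : Z L b <= T%:R) (VH : forall y, 0 <= V y <= H).

(** On the event Z <= T the model error is at most the bonus. Since 1 + gamma H = H, the target r +
    gamma P V lies in [0, H], so clipping preserves the lower bound and caps the excess at H. *)
Lemma newQ_optimistic x a :
  r x a + gamma * \sum_y P x a y * V y <= nQ L b V x a /\
  nQ L b V x a <= r x a + gamma * \sum_y P x a y * V y +
    Num.min (2 * beta * wnorm (invmx L) (feat psi V x a)) H.
Proof.
have pL : posdef L := grows_posdef (@posdef1 R d) gL.
have T1 : (0 : R) < T%:R by rewrite ltr0n.
have /ler_normlP := confidence_width (feat psi V x a) H0 T1 gL (detD pL trL) thetaB good.
rewrite -betaE -(scaleN1r theta) bformDr bformZr feat_mean mulN1r.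
set w := wnorm _ _; set PV := \sum_y P x a y * V y.
have w0 : 0 <= w by exact: sqrtr_ge0.
set e := bform _ _ _ => -[h1 h2].
have PV0 : 0 <= PV.
  by apply: sumr_ge0 => y _; rewrite mulr_ge0 ?(kP x a).1//; case/andP: (VH y).
have PVH : PV <= H.
  rewrite -(distr_mean_const (kP x a) H); apply: ler_sum => y _.
  by rewrite ler_wpM2l ?(kP x a).1//; case/andP: (VH y).
have [r0 r1] := andP (r01 x a).
have -> : nQ L b V x a = clipH H (r x a + beta * w + gamma * e).
  rewrite /nQ /newQ -/w; congr (clipH _ (_ + _ * _)).
  rewrite /e bform1E /feat; under [RHS]eq_bigr do rewrite summxE mulr_suml.
  rewrite exchange_big/=; apply: eq_bigr => y _.
  rewrite mulr_suml; apply: eq_bigr => i _.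
  by rewrite !mxE; ring.
have bw : 0 <= beta * w by rewrite mulr_ge0// ltW.
have gpv : gamma * PV <= gamma * H by rewrite ler_pM2l.
have gpv0 : 0 <= gamma * PV by rewrite mulr_ge0// ltW.
have lo : gamma * PV <= gamma * e + beta * w.
  by have := gpos; have := glt1; nra.
have hi : gamma * e <= gamma * PV + beta * w.
  by have := gpos; have := glt1; nra.
have Hpos := H0; have HE' := HE.
rewrite /clipH; split.
  by rewrite le_max le_min; apply/orP; left; apply/andP; split; lra.
rewrite -lerBlDl le_min; apply/andP; split.
  rewrite lerBlDl ge_max ge_min; apply/andP; split; last lra.
  by apply/orP; left; lra.
rewrite lerBlDl ge_max ge_min; apply/andP; split; last lra.
by apply/orP; right; lra.
Qed.

End Optimism.

(** The increase of ln det guaranteed by [ln_det_growth] when the update at (x, a) closes an epoch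
    begun with [L]. *)
Definition gain (L : 'M[R]_d) V x a : R :=
  Num.min 1 (bform (invmx L) (feat psi V x a) (feat psi V x a)) / 2.

Lemma gain_bounds L V x a : posdef L -> 0 <= gain L V x a <= 1.
Proof.
move=> pL; rewrite /gain.
set q := Num.min _ _.
have q0 : 0 <= q by rewrite le_min ler01 posdef_ge0//; exact: posdef_inv.
have q1 : q <= 1 by rewrite ge_min lexx.
by apply/andP; split; lra.
Qed.

(* AM-GM for small bonuses; for large ones the clipping at [H <= beta] is used. *)
Lemma bonus_le_gain L V x a : posdef L ->
  Num.min (2 * beta * wnorm (invmx L) (feat psi V x a)) H <=
    beta / c + 2 * beta * c * gain L V x a.
Proof.
move=> pL; rewrite /gain /wnorm.
set q := bform (invmx L) _ _.
have -> : ((feat psi V x a)^T *m invmx L *m feat psi V x a) ord0 ord0 = q by [].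
have q0 : 0 <= q by exact/posdef_ge0/posdef_inv.
have ci : c * c^-1 = 1 by rewrite divff// gt_eqF.
have ci0 : 0 < c^-1 by rewrite invr_gt0.
have Hb := Hbeta; have b0 := beta0.
case: (leP 1 q) => q1.
  apply: (@le_trans _ _ H); first by rewrite ge_min lexx orbT.
  have : 1 <= c^-1 + c by have := sqr_ge0 (c - c^-1); nra.
  nra.
apply: (@le_trans _ _ (2 * beta * Num.sqrt q)); first by rewrite ge_min lexx.
set w := Num.sqrt q.
have -> : q = w ^+ 2 by rewrite sqr_sqrtr.
have h : 0 <= (c * w - 1) ^+ 2 * c^-1 by rewrite mulr_ge0 ?sqr_ge0// ltW.
have : 2 * w <= c^-1 + c * w ^+ 2.
  have -> : c^-1 + c * w ^+ 2 = (c * w - 1) ^+ 2 * c^-1 + 2 * w.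
    by field; rewrite gt_eqF.
  lra.
nra.
Qed.

(** [delta] is the drift of one policy update, [rho] the charge per epoch, [kappa] the price of one
    unit of ln det; [c] is the AM-GM weight between the last two. *)
Definition delta : R := 2 * eta * H ^+ 2 + 2 * eta * H ^+ 3.
Definition rho : R := H * (delta + beta / c).
Definition kappa : R := 2 * H * beta * c.

Let rho0 : 0 <= rho.
Proof.
have h1 := ltW H0; have h2 := ltW eta0; have h3 := ltW beta0; have h4 := ltW c0.
by rewrite /rho /delta mulr_ge0// !addr_ge0 ?divr_ge0 ?mulr_ge0 ?exprn_ge0.
Qed.
Let kappa0 : 0 <= kappa.
Proof.
have h1 := ltW H0; have h3 := ltW beta0; have h4 := ltW c0.
by rewrite /kappa !mulr_ge0.
Qed.

Let next_soft pi Q : soft_policy pi -> (forall x a, 0 <= Q x a <= H) ->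
  soft_policy (newpi eta pi Q).
Proof.
move=> [ppi pi0] QH; split; first exact: (newpi_policy eta0 ppi pi0 QH).
by move=> x a; exact: newpi_gt0.
Qed.

Lemma exp_regret_le_rounds n x L b pi V Q : soft_policy pi ->
  (forall x a, 0 <= Q x a <= H) -> regret n x L b pi V Q <= n%:R.
Proof.
elim: n x L b pi V Q => [|n IH] x L b pi V Q spi QH; first by rewrite /regret/=.
rewrite /regret/= -natr1 addrC; apply: lerD; last first.
  by apply: gap_le1 => //; [exact: opt.1 | exact: spi.1].
have [ppi _] := spi.
rewrite -[leRHS](distr_mean_const (policy_distr ppi x) n%:R).
apply: ler_sum => a _; apply: ler_wpM2l; first exact: (ppi x).1.
rewrite -[leRHS](distr_mean_const (kP x a) n%:R).
apply: ler_sum => y _; apply: ler_wpM2l; first exact: (kP x a).1.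
have h1 := IH y (L + feat psi V x a *m (feat psi V x a)^T) (b + V y *: feat psi V x a) pi V Q spi QH.
set S := \sum_z _.
have h2 : S <= n%:R.
  rewrite -[leRHS](distr_mean_const dnu n%:R).
  apply: ler_sum => z _; apply: ler_wpM2l; first exact: dnu.1.
  by apply: IH; [exact: next_soft | exact: newQ_bounds].
rewrite /regret in h1; have := gpos; have := glt1; nra.
Qed.

(** Mid-epoch invariant, with [L0], [b0] frozen and [L], [b] current. The factor H on the gap bounds
    the mean remaining length of the epoch, [(1 - gamma) * n] counts expected resets, and the
    log-determinant budget is already reduced by the gain expected when the epoch ends. The last
    term pays for Z > T. *)
Definition epoch_bound n := forall L0 b0 L b x pi V,
  soft_policy pi -> (forall y, 0 <= V y <= H) ->
  grows 1%:M L0 -> grows L0 L ->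
  \tr L0 <= d%:R + T%:R * (B * H) ^+ 2 ->
  \tr L + n%:R * (B * H) ^+ 2 <= d%:R + T%:R * (B * H) ^+ 2 ->
  Z L0 b0 <= T%:R ->
  regret n x L b pi V (nQ L0 b0 V) <=
    H * gap P gamma r nu0 pis pi
    + H * (Psi (newpi eta pi (nQ L0 b0 V)) (softV eta pi (nQ L0 b0 V)) + H)
    + rho * (1 - gamma) * n%:R
    + kappa * (D + 1 - ln (\det L0) - occ_dot P gamma (Defs.dirac R x) pi (gain L0 V))
    + n%:R * Z L b / T%:R.

(** At an epoch start the gap has been traded for the potential of the current policy; the 1 beside
    [rho] pays for the epoch now starting. *)
Definition start_bound n := forall L b pi V,
  soft_policy pi -> (forall y, 0 <= V y <= H) -> grows 1%:M L ->
  \tr L + n%:R * (B * H) ^+ 2 <= d%:R + T%:R * (B * H) ^+ 2 ->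
  \sum_z nu0 z * regret n z L b pi V (nQ L b V) <=
    H * (Psi pi V + H) + rho * (1 + (1 - gamma) * n%:R)
    + kappa * (D + 1 - ln (\det L)) + n%:R * Z L b / T%:R.

Lemma start_of_epoch n : epoch_bound n -> start_bound n.
Proof.
move=> ep L b pi V spi VH gL trL.
have [ppi pi0] := spi.
have pL : posdef L := grows_posdef (@posdef1 R d) gL.
have trL' : \tr L <= d%:R + T%:R * (B * H) ^+ 2.
  apply: le_trans trL; rewrite lerDl mulr_ge0 ?ler0n ?sqr_ge0//.
have lD := detD pL trL'.
have T1 : (0 : R) < T%:R by rewrite ltr0n.
have Psi0 : 0 <= Psi pi V + H.
  have := potential_ge kP g01 dnu opt.1 eta0 ppi VH; rewrite -/Psi; lra.
have n0 : (0 : R) <= n%:R by exact: ler0n.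
have t1 : 0 <= H * (Psi pi V + H) by rewrite mulr_ge0// ltW.
have t2 : 0 <= kappa * (D + 1 - ln (\det L)) by rewrite mulr_ge0//; lra.
have g1' : 0 <= 1 - gamma by have := glt1; lra.
have t3 : 0 <= rho * (1 + (1 - gamma) * n%:R).
  by rewrite mulr_ge0// addr_ge0// mulr_ge0.
case: (leP (Z L b) T%:R) => good; last first.
  apply: (@le_trans _ _ n%:R).
    rewrite -[leRHS](distr_mean_const dnu n%:R).
    apply: ler_sum => z _; apply: ler_wpM2l; first exact: dnu.1.
    by apply: exp_regret_le_rounds => //; exact: newQ_bounds.
  (* Here Z exceeds T, so the failure term alone covers the trivial bound, and the other terms are
     nonnegative. *)
  have : n%:R <= n%:R * Z L b / T%:R.
    by rewrite -mulrA ler_peMr// ler_pdivlMr// mul1r ltW.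
  lra.
set Q := nQ L b V in ep *.
set K := H * gap P gamma r nu0 pis pi
    + H * (Psi (newpi eta pi Q) (softV eta pi Q) + H)
    + rho * (1 - gamma) * n%:R + n%:R * Z L b / T%:R.
pose j z := occ_dot P gamma (Defs.dirac R z) pi (gain L V).
have step z : regret n z L b pi V Q <= K + kappa * (D + 1 - ln (\det L)) - kappa * j z.
  have := ep L b L b z pi V spi VH gL (grows_refl _) trL' trL good.
  rewrite -/Q /K /j; lra.
have Ej : \sum_z nu0 z * j z = occ_dot P gamma nu0 pi (gain L V).
  exact/esym/(occ_dot_mix kP g01 (gain L V) ppi dnu).
have m0 : \sum_z nu0 z * (K + kappa * (D + 1 - ln (\det L)) - kappa * j z) =
    K + kappa * (D + 1 - ln (\det L)) - kappa * occ_dot P gamma nu0 pi (gain L V).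
  under eq_bigr do rewrite mulrBr mulrCA.
  by rewrite sumrB (distr_mean_const dnu) -mulr_sumr Ej.
apply: le_trans (distr_mean_le dnu step) _; rewrite m0.
have opt1 x a := (newQ_optimistic gL trL' good VH x a).1.
have opt2 x a := (newQ_optimistic gL trL' good VH x a).2.
(* H times the gap becomes a drop in potential, one [rho], and [kappa] times the mean gain, which
   cancels the gain subtracted in [epoch_bound]. *)
have gd := gap_decomposition kP g01 dnu opt.1 eta0 ppi pi0
  (newQ_bounds L b V) etaH opt1 opt2.
have bo : occ_dot P gamma nu0 pi (fun x a => Num.min (2 * beta * wnorm (invmx L) (feat psi V x a)) H)
   <= beta / c + 2 * beta * c * occ_dot P gamma nu0 pi (gain L V).
  have := occ_dot_le kP g01 dnu ppi (fun x a => bonus_le_gain V x a pL).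
  by rewrite occ_dotD (occ_dot_const kP g01 dnu ppi) occ_dotZ.
rewrite -/Q -/Psi -/delta in gd.
have Hgd := ler_wpM2l (ltW H0) (le_trans gd (lerD (lexx _) bo)).
rewrite /K /rho /kappa; lra.
Qed.

(** With no round left every summand must be nonnegative: the gap by optimality, the budget because
    a gain of at most 1 fits into the spare 1 of [D + 1]. *)
Lemma epoch_bound0 : epoch_bound 0.
Proof.
move=> L0 b0 L b x pi V spi VH gL0 gL trL0 trL good.
have [ppi pi0] := spi.
have pL : posdef L0 := grows_posdef (@posdef1 R d) gL0.
have lD := detD pL trL0.
have QH := newQ_bounds L0 b0 V.
have G0 := optimal_gap_ge0 kP g01 opt dnu ppi.
have Psi0 : 0 <= Psi (newpi eta pi (nQ L0 b0 V)) (softV eta pi (nQ L0 b0 V)) + H.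
  have := potential_ge kP g01 dnu opt.1 eta0 (next_soft spi QH).1
    (softV_bounds eta0 ppi QH).
  rewrite -/Psi; lra.
have j1 : occ_dot P gamma (Defs.dirac R x) pi (gain L0 V) <= 1.
  rewrite -[leRHS](occ_dot_const kP g01 (dirac_distr R x) ppi 1).
  apply: occ_dot_le => //; first exact: dirac_distr.
  by move=> z a; case/andP: (gain_bounds V z a pL).
have t1 := mulr_ge0 (ltW H0) G0.
have t2 := mulr_ge0 (ltW H0) Psi0.
have t3 : 0 <= kappa * (D + 1 - ln (\det L0) - occ_dot P gamma (Defs.dirac R x) pi (gain L0 V)).
  by apply: mulr_ge0 => //; lra.
rewrite /regret/= !mul0r mulr0; lra.
Qed.

(* An epoch ends in state-action pair (x, a) with probability given by the
   occupancy measure, and that last update alone increases the log-determinant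
   by at least [gain]. *)
Lemma epoch_boundS n : epoch_bound n -> epoch_bound n.+1.
Proof.
move=> ep L0 b0 L b x pi V spi VH gL0 gL trL0 trL good.
have st := start_of_epoch ep.
have [ppi pi0] := spi.
have pL0 : posdef L0 := grows_posdef (@posdef1 R d) gL0.
have pL : posdef L := grows_posdef pL0 gL.
have gL1 : grows 1%:M L.
  by case: gL0 gL => us -> [vs ->]; exists (us ++ vs); rewrite big_cat addrA.
have QH := newQ_bounds L0 b0 V.
set Q := nQ L0 b0 V in QH *.
have spi2 := next_soft spi QH.
have VH2 := softV_bounds eta0 ppi QH.
set pi2 := newpi eta pi Q in spi2 *; set V2 := softV eta pi Q in VH2 *.
set G := gap P gamma r nu0 pis pi.
pose j z := occ_dot P gamma (Defs.dirac R z) pi (gain L0 V).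
pose L' a := L + feat psi V x a *m (feat psi V x a)^T.
pose b' a y := b + V y *: feat psi V x a.
pose K := gamma * H * G + H * (Psi pi2 V2 + H) + rho * (1 - gamma) * n.+1%:R
  + kappa * (D + 1 - ln (\det L0)).
have T1 : (0 : R) < T%:R by rewrite ltr0n.
have gp := gpos; have gl := glt1.
(* If the epoch continues the induction hypothesis applies with the same frozen data; if it ends,
   [start_bound] applies and the growth of ln det supplies [gain] at (x, a). *)
have step a y : gamma * regret n y (L' a) (b' a y) pi V Q +
    (1 - gamma) * (\sum_z nu0 z * regret n z (L' a) (b' a y) pi2 V2 (nQ (L' a) (b' a y) V2))
   <= K - kappa * ((1 - gamma) * gain L0 V x a + gamma * j y)
      + n%:R / T%:R * Z (L' a) (b' a y).
  have trL' : \tr (L' a) + n%:R * (B * H) ^+ 2 <= d%:R + T%:R * (B * H) ^+ 2.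
    apply: le_trans trL; rewrite /L' linearD/= -natr1.
    have := feat_tr x a VH; lra.
  have e1 := ep L0 b0 (L' a) (b' a y) y pi V spi VH gL0 (grows_rank1 _ gL) trL0 trL' good.
  have e2 := st (L' a) (b' a y) pi2 V2 spi2 VH2 (grows_rank1 _ gL1) trL'.
  have e3 := ler_wpM2l kappa0 (ln_det_growth (feat psi V x a) pL0 gL).
  rewrite -/(gain L0 V x a) -/(L' a) in e3.
  have g1' : 0 <= 1 - gamma by lra.
  have f1 := ler_wpM2l (ltW gp) e1.
  have f2 := ler_wpM2l g1' e2.
  have f3 := ler_wpM2l g1' e3.
  rewrite -/Q -/pi2 -/V2 -/G -/(j y) in f1 f2.
  apply: le_trans (lerD f1 f2) _.
  rewrite /K -natr1.
  move: f3; set zz := Z _ _; lra.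
have jx : j x = \sum_a pi x a * ((1 - gamma) * gain L0 V x a + gamma * \sum_y P x a y * j y).
  exact: (occ_dot_dirac kP g01 (gain L0 V) x ppi).
have q0 : 0 <= n%:R / T%:R :> R by rewrite divr_ge0 ?ler0n.
have inner a : \sum_y P x a y * (K - kappa * ((1 - gamma) * gain L0 V x a + gamma * j y)
      + n%:R / T%:R * Z (L' a) (b' a y)) <=
    K + n%:R / T%:R * Z L b
      - kappa * ((1 - gamma) * gain L0 V x a + gamma * \sum_y P x a y * j y).
  have sm := selfnorm_supermartingale b H0 (kP x a) VH (feat_mean V x a) pL.
  rewrite -/Z in sm.
  have -> : \sum_y P x a y * (K - kappa * ((1 - gamma) * gain L0 V x a + gamma * j y)
      + n%:R / T%:R * Z (L' a) (b' a y)) =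
      \sum_y P x a y * (K - kappa * ((1 - gamma) * gain L0 V x a))
      - kappa * gamma * (\sum_y P x a y * j y)
      + n%:R / T%:R * (\sum_y P x a y * Z (L' a) (b' a y)).
    rewrite !mulr_sumr -sumrB -big_split/=; apply: eq_bigr => y _; ring.
  rewrite (distr_mean_const (kP x a)).
  have := ler_wpM2l q0 sm; rewrite -/(L' a) /b'; lra.
have total : \sum_a pi x a * (\sum_y P x a y * (gamma * regret n y (L' a) (b' a y) pi V Q +
    (1 - gamma) * (\sum_z nu0 z * regret n z (L' a) (b' a y) pi2 V2 (nQ (L' a) (b' a y) V2))))
   <= K + n%:R / T%:R * Z L b - kappa * j x.
  have h a := le_trans (distr_mean_le (kP x a) (step a)) (inner a).
  apply: le_trans (distr_mean_le (policy_distr ppi x) h) _.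
  pose w a := (1 - gamma) * gain L0 V x a + gamma * \sum_y P x a y * j y.
  rewrite jx.
  have -> : \sum_a pi x a * (K + n%:R / T%:R * Z L b - kappa * w a) =
      \sum_a pi x a * (K + n%:R / T%:R * Z L b) - kappa * \sum_a pi x a * w a.
    by rewrite [kappa * _]mulr_sumr -sumrB; apply: eq_bigr => a _; ring.
  by rewrite (distr_mean_const (policy_distr ppi x)).
have -> : regret n.+1 x L b pi V Q = G +
  \sum_a pi x a * (\sum_y P x a y * (gamma * regret n y (L' a) (b' a y) pi V Q +
    (1 - gamma) * (\sum_z nu0 z * regret n z (L' a) (b' a y) pi2 V2 (nQ (L' a) (b' a y) V2)))) by [].
apply: le_trans (lerD (lexx G) total) _.
have Z0 := selfnorm_ge0 theta H L b; rewrite -/Z in Z0.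
have zz : n%:R / T%:R * Z L b <= n.+1%:R * Z L b / T%:R.
  rewrite mulrAC ler_pM2r ?invr_gt0// -natr1; lra.
(* The gap of this round and the discounted remainder gamma H G recombine into H G. *)
have HG : H * G = G + gamma * H * G by rewrite {1}HE mulrDl mul1r.
rewrite HG /K -/(j x); lra.
Qed.

(** Initially ln det = 0 and Z = 1, so the failure term is T / T, the final 1. *)
Lemma regret_potential_bound pi V : soft_policy pi -> (forall y, 0 <= V y <= H) ->
  \sum_z nu0 z * regret T z 1%:M 0 pi V (nQ 1%:M 0 V) <=
    H * (Psi pi V + H) + rho * (1 + (1 - gamma) * T%:R) + kappa * (D + 1) + 1.
Proof.
move=> spi VH.
have ep : forall n, epoch_bound n.
  by elim=> [|n]; [exact: epoch_bound0 | exact: epoch_boundS].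
have := start_of_epoch (ep T) 0 spi VH (grows_refl _).
rewrite mxtrace1 lexx => /(_ isT).
by rewrite det1 ln1 subr0 /Z selfnorm_init mulr1 divff// gt_eqF// ltr0n.
Qed.

End Regret.

(** * Numerical estimates for the final rate *)

Section FinalBound.
Variable R : realType.

Lemma ln2_ge_half : (2^-1 : R) <= ln 2.
Proof.
have h : 0 <= (1 : R) <= 1 by rewrite ler01 lexx.
have := expR_half_le h; rewrite -[1 + 1]/(2 : R) div1r => h2.
by rewrite -ler_expR lnK ?posrE//; apply: le_trans h2 _; lra.
Qed.

Lemma le_sqrt_of_sqr (x y : R) : 0 <= x -> x ^+ 2 <= y -> x <= Num.sqrt y.
Proof. by move=> x0 h; rewrite -[x]ger0_norm// -sqrtr_sqr ler_wsqrtr. Qed.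

(* Here [h], [a], [t], [q] stand for the square roots of H, log|A|, T and d. *)
Lemma regret_arithmetic (h a t q B l eta beta D Y : R) :
  1 <= h -> 2^-1 <= a ^+ 2 -> 0 < a -> 0 < t -> 1 <= q -> 0 <= B -> 1 <= l ->
  a / (h ^+ 2 * t) <= eta -> eta <= 2 * a / (h ^+ 2 * t) ->
  0 <= beta -> beta <= 2 * h ^+ 2 * l * q + B -> D <= 2 * q ^+ 2 * l ->
  4 * h ^+ 4 * a <= t ->
  h ^+ 4 * a * t <= Y -> q ^+ 2 * h ^+ 3 * t <= Y -> B * q * h * t <= Y ->
  h ^+ 2 * (eta^-1 * a ^+ 2 + h ^+ 2) +
  rho (1 - h ^- 2) eta beta (t / (h * q)) * (1 + h ^- 2 * t ^+ 2) +
  kappa (1 - h ^- 2) beta (t / (h * q)) * (D + 1) + 1 <= 50 * l ^+ 2 * Y.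
Proof.
move=> h1 a2 a0 t0 q1 B0 l1 e1 e2 b0 b1 D1 ht Y1 Y2 Y3.
have h0 : 0 < h by lra.
have q0 : 0 < q by lra.
have H1 : 1 <= h ^+ 2 by rewrite exprn_ege1.
have H2 : 1 <= h ^+ 4 by rewrite exprn_ege1.
have HH : h ^+ 2 <= h ^+ 4 by rewrite ler_weXn2l.
have Ht : 0 < h ^+ 2 * t by rewrite mulr_gt0// exprn_gt0.
have eta0 : 0 < eta by apply: lt_le_trans e1; rewrite divr_gt0.
have l2 : l <= l ^+ 2 by rewrite expr2 ler_peMl//; lra.
have l3 : 1 <= l ^+ 2 by rewrite exprn_ege1.
have at2 : 2 <= a * t by nra.
have y1 : h ^+ 4 <= h ^+ 4 * a * t.
  by rewrite -mulrA ler_peMr//; lra.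
have Y0 : 0 <= Y by lra.
have A1 : h ^+ 2 * (eta^-1 * a ^+ 2 + h ^+ 2) <= 2 * Y.
  have ie : eta^-1 <= h ^+ 2 * t / a.
    rewrite -[leRHS]invrK lef_pV2 ?posrE ?invr_gt0 ?divr_gt0// invf_div.
    exact: e1.
  have : eta^-1 * a ^+ 2 <= h ^+ 2 * t * a.
    have := ler_wpM2r (sqr_ge0 a) ie.
    have -> // : h ^+ 2 * t / a * a ^+ 2 = h ^+ 2 * t * a by field; rewrite gt_eqF.
  move=> /(ler_wpM2l (ltW (lt_le_trans ltr01 H1))).
  have -> : h ^+ 2 * (h ^+ 2 * t * a) = h ^+ 4 * a * t by ring.
  have -> : h ^+ 2 * (eta^-1 * a ^+ 2 + h ^+ 2) = h ^+ 2 * (eta^-1 * a ^+ 2) + h ^+ 4 by ring.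
  lra.
have bq : beta * (h * q * t) <= 3 * l * Y.
  have p : 0 <= h * q * t by rewrite !mulr_ge0// ltW.
  apply: le_trans (ler_wpM2r p b1) _.
  have -> : (2 * h ^+ 2 * l * q + B) * (h * q * t) =
    2 * l * (q ^+ 2 * h ^+ 3 * t) + B * q * h * t by ring.
  have l0 : 0 <= 2 * l by lra.
  have := ler_wpM2l l0 Y2; nra.
have Hi : (1 - (1 - h ^- 2))^-1 = h ^+ 2.
  by rewrite opprB addrCA subrr addr0 invrK.
rewrite /rho /kappa /delta Hi.
(* Up to logarithms this weight balances the epoch charge T beta / c against the determinant charge
   H beta c D, with D of order q^2. *)
set c := t / (h * q).
have hn : h != 0 by rewrite gt_eqF.
have qn : q != 0 by rewrite gt_eqF.
have tn : t != 0 by rewrite gt_eqF.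
have A2 : h ^+ 2 * (2 * eta * (h ^+ 2) ^+ 2 + 2 * eta * (h ^+ 2) ^+ 3 + beta / c) *
    (1 + h ^- 2 * t ^+ 2) <= 16 * Y + 6 * l * Y.
  (* Thus the charge for the first epoch at most doubles the epoch term. *)
  have tT : h ^+ 2 <= t ^+ 2.
    have : 4 * h ^+ 4 * a * (4 * h ^+ 4 * a) <= t * t.
      by rewrite ler_pM// !mulr_ge0// ltW.
    have : 0 <= h ^+ 4 * h ^+ 4 * (a ^+ 2 - 2^-1) by rewrite !mulr_ge0//; lra.
    have : h ^+ 4 <= h ^+ 4 * h ^+ 4 by rewrite ler_peMr//; lra.
    lra.
  set W := 2 * eta * _ + _ + _.
  have W0 : 0 <= W.
    by rewrite /W !addr_ge0 ?divr_ge0 ?mulr_ge0 ?exprn_ge0// ltW.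
  apply: (@le_trans _ _ (2 * t ^+ 2 * W)).
    have -> : h ^+ 2 * W * (1 + h ^- 2 * t ^+ 2) = (h ^+ 2 + t ^+ 2) * W.
      by field.
    by apply: ler_wpM2r => //; lra.
  have w1 : t ^+ 2 * (beta / c) = beta * (h * q * t).
    by rewrite /c; field; rewrite ?hn ?qn ?tn.
  have w2 : t ^+ 2 * (2 * eta * (h ^+ 2) ^+ 2 + 2 * eta * (h ^+ 2) ^+ 3) <= 8 * Y.
    have : eta * (h ^+ 6 * t ^+ 2) <= 2 * (h ^+ 4 * a * t).
      have p : 0 <= h ^+ 6 * t ^+ 2 by rewrite mulr_ge0 ?exprn_ge0 ?(ltW h0) ?(ltW t0).
      apply: le_trans (ler_wpM2r p e2) _.
      by rewrite le_eqVlt; apply/orP; left; apply/eqP; field; rewrite ?hn ?qn ?tn.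
    have : h ^+ 4 * (eta * t ^+ 2) <= h ^+ 6 * (eta * t ^+ 2).
      by rewrite ler_wpM2r ?ler_weXn2l// mulr_ge0 ?sqr_ge0 ?(ltW eta0).
    lra.
  rewrite /W; lra.
have A3 : 2 * h ^+ 2 * beta * c * (D + 1) <= 18 * l ^+ 2 * Y.
  have c0 : 0 <= 2 * h ^+ 2 * beta * c.
    by rewrite /c !mulr_ge0 ?invr_ge0 ?mulr_ge0 ?exprn_ge0// ltW.
  have D2 : D + 1 <= 3 * q ^+ 2 * l.
    have : 1 <= q ^+ 2 * l by rewrite mulr_ege1// exprn_ege1.
    lra.
  apply: le_trans (ler_wpM2l c0 D2) _.
  have -> : 2 * h ^+ 2 * beta * c * (3 * q ^+ 2 * l) = 6 * l * (beta * (h * q * t)).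
    by rewrite /c; field; rewrite ?hn ?qn ?tn.
  have l0 : 0 <= 6 * l by lra.
  have := ler_wpM2l l0 bq; lra.
have : l * Y <= l ^+ 2 * Y by rewrite ler_wpM2r.
have : Y <= l ^+ 2 * Y by rewrite ler_peMl.
lra.
Qed.

Lemma ln_confidence_le (T B H d l : R) : 0 <= T -> 0 <= B -> 1 <= H -> 1 <= d ->
  ln (1 + T) + ln (1 + B) + ln (1 + H) <= l ->
  ln (1 + T * B ^+ 2 * H ^+ 2 / d) <= 2 * l.
Proof.
move=> T0 B0 H1 d1 hl.
have lT : 0 <= ln (1 + T) by apply: ln_ge0; lra.
have pd : 0 < d by lra.
have x0 : 0 <= T * B ^+ 2 * H ^+ 2.
  by apply: mulr_ge0; [apply: mulr_ge0 => //|]; exact: sqr_ge0.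
have xd : T * B ^+ 2 * H ^+ 2 / d <= T * B ^+ 2 * H ^+ 2.
  by rewrite ler_pdivrMr// ler_peMr.
have xd0 : 0 <= T * B ^+ 2 * H ^+ 2 / d by rewrite divr_ge0// ltW.
have pT : 0 < 1 + T by lra.
have pB : 0 < 1 + B by lra.
have pH : 0 < 1 + H by lra.
apply: (@le_trans _ _ (ln ((1 + T) * (1 + B) ^+ 2 * (1 + H) ^+ 2))).
  rewrite ler_ln ?posrE; [|lra|by rewrite !mulr_gt0 ?exprn_gt0].
  apply: (@le_trans _ _ (1 + T * B ^+ 2 * H ^+ 2)); first lra.
  have b1 : B ^+ 2 <= (1 + B) ^+ 2 by rewrite lerXn2r ?nnegrE//; lra.
  have b2 : H ^+ 2 <= (1 + H) ^+ 2 by rewrite lerXn2r ?nnegrE//; lra.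
  have b3 : 1 <= (1 + B) ^+ 2 * (1 + H) ^+ 2.
    by rewrite mulr_ege1// exprn_ege1//; lra.
  have b4 : B ^+ 2 * H ^+ 2 <= (1 + B) ^+ 2 * (1 + H) ^+ 2.
    by rewrite ler_pM ?sqr_ge0.
  have := ler_wpM2l T0 b4; lra.
have pB2 : 0 < (1 + B) ^+ 2 by rewrite exprn_gt0.
have pH2 : 0 < (1 + H) ^+ 2 by rewrite exprn_gt0.
have pTB : 0 < (1 + T) * (1 + B) ^+ 2 by rewrite mulr_gt0.
rewrite (lnM pTB pH2) (lnM pT pB2) !lnXn// !mulr2n; lra.
Qed.

End FinalBound.

(** * Instantiation with the prescribed step size and confidence width *)

Theorem theorem2 (R : realType) :
  exists (C : R) (k : nat), 0 < C /\
  forall (X A : finType) (d : nat) (P : X -> A -> X -> R) (gamma : R)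
         (psi : X -> A -> X -> 'cV[R]_d) (theta : 'cV[R]_d) (B : R)
         (r : X -> A -> R) (nu0 : X -> R) (pis : X -> A -> R) (T : nat),
    (1 < #|A|)%N -> (1 <= T)%N ->
    0 < gamma < 1 ->
    (forall x a, 0 <= r x a <= 1) ->
    is_distr nu0 ->
    is_kernel P ->
    (* linear mixture assumption *)
    (forall x a y, P x a y = \sum_i theta i ord0 * psi x a y i ord0) ->
    norm2 theta <= B ->
    (forall x a (V : X -> R), (forall y, 0 <= V y <= (1 - gamma)^-1) ->
        norm2 (\sum_y V y *: psi x a y) <= B * (1 - gamma)^-1) ->
    optimal_policy P gamma r pis ->
    let H := (1 - gamma)^-1 in
    let lnA := ln (#|A|%:R : R) in
    let eta := Num.sqrt (2 * lnA / (H ^+ 2 * T%:R)) in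
    let beta := H * Num.sqrt (2 * ((d%:R / 2) *
                    ln (1 + T%:R * B ^+ 2 * H ^+ 2 / d%:R) + ln (T%:R : R))) + B in
    let pi0 := fun (_ : X) (_ : A) => (#|A|%:R : R)^-1 in
    let Q1 := fun (_ : X) (_ : A) => (0 : R) in
    let polylog := 1 + ln (1 + T%:R) + ln (1 + B) + ln (1 + d%:R) + ln (1 + H) in
    ravi_ucb_regret P gamma psi r nu0 eta beta H pis T 1 pi0 Q1
      <= C * polylog ^+ k *
         Num.sqrt ((d%:R ^+ 2 * H ^+ 3 + B ^+ 2 * d%:R * H + H ^+ 4 * lnA) * T%:R).
Proof.
(* One logarithmic factor comes from [beta] and one from [D]; 50 dominates the constants collected
   in [regret_arithmetic]. *)
exists 50, 2%N; split => //.
move=> X A d P gamma psi theta B r nu0 pis T A1 T1 g01 r01 dnu kP mix thetaB featB opt.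
cbv zeta; set H := (1 - gamma)^-1; set lnA := ln _%:R.
set eta := Num.sqrt (_ / (H ^+ 2 * _)); set beta := H * _ + B.
set pi0 := fun (_ : X) (_ : A) => #|A|%:R^-1; set Q1 := fun (_ : X) (_ : A) => 0.
set polylog := 1 + _ + _ + _ + _.
have [g0 g1] := andP g01.
have H0 : 0 < H by rewrite invr_gt0; lra.
have H1 : 1 <= H by rewrite -[H]div1r ler_pdivlMr; lra.
have TR : (1 : R) <= T%:R by rewrite ler1n.
have lnA2 : 2^-1 <= lnA.
  apply: le_trans (ln2_ge_half R) _; rewrite ler_ln ?posrE ?ler_nat// ltr0n.
  exact: ltn_trans A1.
have cA : (0 : R) < #|A|%:R by rewrite ltr0n (ltn_trans _ A1).
have B0 : 0 <= B by apply: le_trans thetaB; exact: sqrtr_ge0.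
(* For d = 0 the mixture would make every transition probability zero, against total mass 1. *)
have d0 : (0 < d)%N.
  rewrite lt0n; apply/eqP => d0.
  have /card_gt0P[a _] : (0 < #|A|)%N by exact: ltn_trans A1.
  have [x _|X0] := pickP (fun _ : X => true); last first.
    by have := dnu.2; rewrite big1 => [/eqP|x]; rewrite ?(eq_sym 0) ?oner_eq0//; have := X0 x.
  have := (kP x a).2; rewrite big1 => [/eqP|y _]; first by rewrite eq_sym oner_eq0.
  by rewrite mix big1// => i; have := ltn_ord i; rewrite {2}d0.
have dR : (1 : R) <= d%:R by rewrite ler1n.
have ppi0 : is_policy pi0.
  move=> x; split=> [a|]; first by rewrite invr_ge0 ltW.
  by rewrite sumr_const -[LHS]mulr_natr mulVf// gt_eqF.
have pi0_gt0 x a : 0 < pi0 x a by rewrite invr_gt0.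
have lT : 0 <= ln (1 + T%:R : R) by apply: ln_ge0; lra.
have lB : 0 <= ln (1 + B) by apply: ln_ge0; lra.
have lH : 0 <= ln (1 + H) by apply: ln_ge0; lra.
have ld : 0 <= ln (1 + d%:R : R) by apply: ln_ge0; lra.
have l1 : 1 <= polylog by rewrite /polylog; lra.
have T0 : (0 : R) < T%:R by lra.
have lnA0 : 0 < lnA by lra.
have arg0 : 0 < 2 * lnA / (H ^+ 2 * T%:R).
  by rewrite divr_gt0 ?mulr_gt0 ?exprn_gt0.
have eta0 : 0 < eta by rewrite sqrtr_gt0.
have QH (x : X) (a : A) : 0 <= Q1 x a <= H by rewrite lexx ltW.
have spi : soft_policy (newpi eta pi0 Q1).
  split; first exact: (newpi_policy eta0 ppi0 pi0_gt0 QH).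
  by move=> x a; exact: newpi_gt0.
have VH := softV_bounds eta0 ppi0 QH.
set Y := Num.sqrt (_ * T%:R).
pose a := Num.sqrt lnA; pose t := Num.sqrt (T%:R : R).
pose h := Num.sqrt H; pose q := Num.sqrt (d%:R : R).
have aE : a ^+ 2 = lnA by rewrite sqr_sqrtr// ltW.
have tE : t ^+ 2 = T%:R by rewrite sqr_sqrtr// ltW.
have hE : h ^+ 2 = H by rewrite sqr_sqrtr// ltW.
have qE : q ^+ 2 = d%:R by rewrite sqr_sqrtr//; lra.
have a0 : 0 < a by rewrite sqrtr_gt0.
have t0 : 0 < t by rewrite sqrtr_gt0.
have h1 : 1 <= h by apply: le_sqrt_of_sqr => //; rewrite expr1n.
have q1 : 1 <= q by apply: le_sqrt_of_sqr => //; rewrite expr1n.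
have h0 : 0 < h by lra.
have q0 : 0 < q by lra.
have s1 : 0 <= d%:R ^+ 2 * H ^+ 3 * T%:R by rewrite !mulr_ge0 ?exprn_ge0 ?(ltW H0).
have s2 : 0 <= B ^+ 2 * d%:R * H * T%:R by rewrite !mulr_ge0 ?exprn_ge0 ?(ltW H0).
have s3 : 0 <= H ^+ 4 * lnA * T%:R by rewrite !mulr_ge0 ?exprn_ge0 ?(ltW H0) ?(ltW lnA0).
have Y1 : h ^+ 4 * a * t <= Y.
  apply: le_sqrt_of_sqr; first by rewrite !mulr_ge0 ?exprn_ge0// ltW.
  have -> : (h ^+ 4 * a * t) ^+ 2 = (h ^+ 2) ^+ 4 * a ^+ 2 * t ^+ 2 by ring.
  rewrite aE tE hE; lra.
have Y2 : q ^+ 2 * h ^+ 3 * t <= Y.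
  apply: le_sqrt_of_sqr; first by rewrite !mulr_ge0 ?exprn_ge0// ltW.
  have -> : (q ^+ 2 * h ^+ 3 * t) ^+ 2 = (q ^+ 2) ^+ 2 * (h ^+ 2) ^+ 3 * t ^+ 2 by ring.
  rewrite qE tE hE; lra.
have Y3 : B * q * h * t <= Y.
  apply: le_sqrt_of_sqr; first by rewrite !mulr_ge0// ltW.
  have -> : (B * q * h * t) ^+ 2 = B ^+ 2 * q ^+ 2 * h ^+ 2 * t ^+ 2 by ring.
  rewrite qE tE hE; lra.
have Y0 : 0 <= Y by exact: sqrtr_ge0.
(* For small T the trivial bound T = t * t is at most 4 Y. Otherwise T is large enough for eta H <=
   1/2 and H <= beta. *)
have [big|small] := leP (4 * h ^+ 4 * a) t; last first.
  apply: (@le_trans _ _ T%:R).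
    rewrite -[leRHS](distr_mean_const dnu T%:R).
    apply: ler_sum => z _; apply: ler_wpM2l; first exact: dnu.1.
    apply: exp_regret_le_rounds => // x b.
    exact: newQ_bounds.
  have -> : T%:R = t * t by rewrite -expr2 tE.
  have := ler_wpM2r (ltW t0) (ltW small).
  have : Y <= polylog ^+ 2 * Y by rewrite ler_peMl// exprn_ege1.
  lra.
have D1 : ln (1 + T%:R * B ^+ 2 * H ^+ 2 / d%:R) <= 2 * polylog.
  by apply: ln_confidence_le => //; rewrite /polylog; lra.
have D0 : 0 <= ln (1 + T%:R * B ^+ 2 * H ^+ 2 / d%:R).
  apply: ln_ge0; rewrite lerDl divr_ge0 ?ler0n// !mulr_ge0 ?exprn_ge0// ltW//.
(* This is d ln s, where d s is the largest trace allowed by the feature bound. *)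
pose D := d%:R * ln (1 + T%:R * B ^+ 2 * H ^+ 2 / d%:R).
have betaE : beta = H * Num.sqrt (2 * (D / 2 + ln (T%:R : R))) + B.
  by rewrite /beta /D; congr (_ * Num.sqrt (2 * (_ + _)) + _); ring.
have DD0 : 0 <= D by rewrite mulr_ge0.
have H4 : 1 <= h ^+ 4 by rewrite exprn_ege1.
have at2 : 2 <= a * t.
  have := ler_wpM2l (ltW a0) big.
  have : 0 <= (h ^+ 4 - 1) * a ^+ 2 by rewrite mulr_ge0 ?sqr_ge0//; lra.
  lra.
have T4 : (4 : R) <= T%:R.
  have : 2 * 2 <= t * t.
    have : 4 * a <= t by apply: le_trans big; rewrite ler_wpM2r ?(ltW a0)//; lra.
    nra.
  by rewrite -tE expr2; lra.
have lnT1 : 1 <= ln (T%:R : R).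
  apply: (@le_trans _ _ (ln (2 * 2))); last by rewrite ler_ln ?posrE//; lra.
  by rewrite lnM ?posrE//; have := ln2_ge_half R; lra.
have Hbeta : H <= beta.
  rewrite betaE; apply: (@le_trans _ _ (H * Num.sqrt (2 * (D / 2 + ln (T%:R : R))))); last lra.
  rewrite ler_peMr// ?(ltW H0)//; apply: le_sqrt_of_sqr => //; rewrite expr1n; lra.
have e1 : a / (h ^+ 2 * t) <= eta.
  apply: le_sqrt_of_sqr; first by rewrite divr_ge0 ?mulr_ge0 ?exprn_ge0// ltW.
  by rewrite hE expr_div_n exprMn aE tE ler_pM2r ?invr_gt0 ?mulr_gt0 ?exprn_gt0//; lra.
have e2 : eta <= 2 * a / (h ^+ 2 * t).
  have p : 0 <= 2 * a / (h ^+ 2 * t) by rewrite divr_ge0 ?mulr_ge0 ?exprn_ge0// ltW.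
  rewrite -[leRHS]ger0_norm// -sqrtr_sqr; apply: ler_wsqrtr.
  rewrite hE expr_div_n !exprMn aE tE ler_pM2r ?invr_gt0 ?mulr_gt0 ?exprn_gt0//; lra.
have etaH : eta * H <= 2^-1.
  apply: le_trans (ler_wpM2r (ltW H0) e2) _; rewrite -hE.
  have -> : 2 * a / (h ^+ 2 * t) * h ^+ 2 = 2 * a / t.
    by field; rewrite !gt_eqF.
  rewrite ler_pdivrMr//; have : a <= h ^+ 4 * a by rewrite ler_peMl// ltW.
  lra.
have c0 : 0 < t / (h * q) by rewrite divr_gt0 ?mulr_gt0.
have detD (L : 'M[R]_d) : posdef L ->
    \tr L <= d%:R + T%:R * (B * H) ^+ 2 -> ln (\det L) <= D.
  move=> pL trL; apply: ln_det_le => //.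
    by rewrite ltr_wpDr// divr_ge0// !mulr_ge0 ?exprn_ge0// ltW.
  apply: le_trans trL _; rewrite le_eqVlt; apply/orP; left; apply/eqP.
  by field; rewrite gt_eqF//; lra.
have main := regret_potential_bound T1 g01 r01 dnu kP mix thetaB featB opt eta0 etaH
  c0 betaE Hbeta detD spi VH.
rewrite -/H in main.
apply: le_trans main _.
have V10 x : softV eta pi0 Q1 x = 0.
  rewrite /softV; under eq_bigr do rewrite mulr0 expR0.
  by rewrite (distr_mean_const (policy_distr ppi0 x)) ln1 mulr0.
have pi1E x b : newpi eta pi0 Q1 x b = #|A|%:R^-1.
  by rewrite /newpi V10 subrr mulr0 expR0 mulr1.
(* As [Q1] is zero the first update keeps the uniform policy, and only the entropy part of the
   potential survives. *)
have PsiE : potential P gamma nu0 pis eta (newpi eta pi0 Q1) (softV eta pi0 Q1) =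
    eta^-1 * lnA.
  rewrite /potential.
  have -> : occ_dot P gamma nu0 pis (fun x b => ln (newpi eta pi0 Q1 x b)) =
      occ_dot P gamma nu0 pis (fun _ _ => - lnA).
    apply: eq_bigr => x _; apply: eq_bigr => b _.
    by rewrite pi1E lnV ?posrE.
  rewrite (occ_dot_const kP g01 dnu opt.1).
  rewrite (occ_dot_state _ _ _ spi.1) (occ_dot_state _ _ _ opt.1).
  rewrite big1 => [|x _]; last by rewrite V10 mulr0.
  rewrite big1 => [|x _]; last by rewrite V10 mulr0.
  ring.
have hg : gamma = 1 - h ^- 2 by rewrite hE invrK; ring.
have gh : 1 - gamma = h ^- 2 by rewrite hE invrK.
rewrite PsiE gh -aE -hE -tE {1}hg {1}hg.
apply: (@regret_arithmetic R h a t q B) => //.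
- by rewrite aE.
- exact: le_trans (ltW H0) Hbeta.
- rewrite betaE hE lerD2r.
  have -> : 2 * H * polylog * q = H * (2 * (polylog * q)) by ring.
  apply: ler_wpM2l; first exact: ltW.
  have p : 0 <= 2 * (polylog * q) by rewrite !mulr_ge0// ltW//; lra.
  rewrite -[leRHS]ger0_norm// -sqrtr_sqr; apply: ler_wsqrtr.
  have -> : (2 * (polylog * q)) ^+ 2 = 4 * polylog ^+ 2 * q ^+ 2 by ring.
  rewrite qE.
  have lTl : ln (T%:R : R) <= polylog.
    apply: (@le_trans _ _ (ln (1 + T%:R))); last by rewrite /polylog; lra.
    by rewrite ler_ln ?posrE; lra.
  have Dl : D <= d%:R * (2 * polylog) by rewrite ler_wpM2l.
  have : polylog <= d%:R * polylog by rewrite ler_peMl//; lra.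
  have : d%:R * polylog <= d%:R * (polylog * polylog).
    by rewrite ler_wpM2l// ler_peMl//; lra.
  lra.
- rewrite qE -mulrA mulrCA; exact: ler_wpM2l.
Qed.
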